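(* Let $\mathcal{W}=\boldsymbol{w_1}\otimes\cdots\otimes\boldsymbol{w_n}\in\mathbb{R}^{d_1\times\cdots\times d_n}$ (outer product of vectors $\boldsymbol{w_k}\in\mathbb{R}^{d_k}$) have strictly positive entries, and fix $\Omega\subseteq[d_1]\times\cdots\times[d_n]$. Suppose that $\mathcal{T}\in\mathbb{R}^{d_1\times\cdots\times d_n}$ has Tucker rank $\boldsymbol{r}=[r_1,\dots,r_n]$. Let $\sigma>0$, let $\mathcal{Z}\in\mathbb{R}^{d_1\times\cdots\times d_n}$ have i.i.d. entries $\mathcal{Z}_{i_1\cdots i_n}\sim\mathcal{N}(0,\sigma^2)$, put $\mathcal{Y}_\Omega=\boldsymbol{1}_\Omega\boxdot(\mathcal{T}+\mathcal{Z})$, and let $$\widehat{\mathcal{T}}=\mathcal{W}^{(-1/2)}\boxdot\left((\mathcal{W}^{(-1/2)}\boxdot\mathcal{Y}_\Omega)\times_1\widehat{U}_1\widehat{U}_1^T\times_2\cdots\times_n\widehat{U}_n\widehat{U}_n^T\right),$$ where $\widehat{U}_1,\dots,\widehat{U}_n$ are obtained by the HOSVD approximation process, i.e. the columns of $\widehat{U}_k\in\mathbb{R}^{d_k\times r_k}$ are the first $r_k$ left singular vectors (for singular values in decreasing order) of the unfolding $(\mathcal{W}^{(-1/2)}\boxdot\mathcal{Y}_\Omega)_{(k)}$. Then with probability at least $1-\sum_{i=1}^n\frac{1}{d_i+\prod_{j\neq i}d_j}$ over the choice of $\mathcal{Z}$, $$\left\|\mathcal{W}^{(1/2)}\boxdot(\mathcal{T}-\widehat{\mathcal{T}})\right\|_F\leq\left(\sum_{k=1}^n6\sqrt{r_k\log\Big(d_k+\prod_{j\neq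 k}d_j\Big)}\,\mu_k\right)\sigma+\left(\sum_{k=1}^n3r_k\left\|(\mathcal{W}^{(-1/2)}\boxdot\boldsymbol{1}_\Omega-\mathcal{W}^{(1/2)})_{(k)}\right\|_2\right)\|\mathcal{T}\|_\infty,$$ where $$\mu_k^2=\max\left\{\max_{i_k}\left(\sum_{i_1,\dots,i_{k-1},i_{k+1},\dots,i_n}\frac{1_{(i_1,\dots,i_n)\in\Omega}}{\mathcal{W}_{i_1\cdots i_n}}\right),\ \max_{i_1,\dots,i_{k-1},i_{k+1},\dots,i_n}\left(\sum_{i_k}\frac{1_{(i_1,\dots,i_n)\in\Omega}}{\mathcal{W}_{i_1\cdots i_n}}\right)\right\}.$$
   Context: Notation. $[d]=\{1,\dots,d\}$. $\boldsymbol{1}_\Omega\in\mathbb{R}^{d_1\times\cdots\times d_n}$ is the tensor with entries $1$ on $\Omega$ and $0$ elsewhere; $1_{(i_1,\dots,i_n)\in\Omega}$ is the indicator. $\boxdot$ is the entrywise (Hadamard) product and $\mathcal{X}^{(\alpha)}$ the entrywise power, $(\mathcal{X}^{(\alpha)})_{i_1\cdots i_n}=\mathcal{X}_{i_1\cdots i_n}^\alpha$. $\|\cdot\|_F$ is the Frobenius norm, $\|\mathcal{X}\|_\infty=\max|\mathcal{X}_{i_1\cdots i_n}|$, and $\|\cdot\|_2$ of a matrix is the spectral (operator) norm. The outer product is $(\boldsymbol{a}_1\otimes\cdots\otimes\boldsymbol{a}_n)_{i_1\cdots i_n}=\prod_k\boldsymbol{a}_k(i_k)$. The mode-$k$ unfolding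 $\mathcal{X}_{(k)}\in\mathbb{R}^{d_k\times\prod_{j\ne k}d_j}$ is the matrix whose columns are the vectors obtained from $\mathcal{X}$ by fixing all indices except the $k$-th. The Tucker rank of $\mathcal{X}$ is $(r_1,\dots,r_n)$ with $r_k=\operatorname{rank}(\mathcal{X}_{(k)})$. The mode-$k$ product of $\mathcal{X}$ with $U\in\mathbb{R}^{d_k\times J}$ is $(\mathcal{X}\times_kU)_{i_1,\dots,i_{k-1},j,i_{k+1},\dots,i_n}=\sum_{s=1}^{d_k}\mathcal{X}_{i_1,\dots,i_{k-1},s,i_{k+1},\dots,i_n}U_{s,j}$. *)

(* Defs.v *)
From HB Require Import structures.
From mathcomp Require Import all_boot all_order all_algebra.
From mathcomp Require Import all_classical all_reals all_analysis.

Set Implicit Arguments.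
Unset Strict Implicit.
Unset Printing Implicit Defensive.

Import Order.TTheory GRing.Theory Num.Theory.
Local Open Scope classical_set_scope.
Local Open Scope ring_scope.

(* Multi-indices (i_1, ..., i_n) and real tensors of shape d_1 x ... x d_n;
   indices and modes are numbered from 0. *)
Notation midx d := {dffun forall k, 'I_(d k)}.
Notation tensor R d := {ffun midx d -> R}.

(* Multi-indices with the k-th component left out. *)
Notation cidx d k := {dffun forall j : {j | j != k}, 'I_(d (val j))}.

Section Tensors.
Context {R : realType} {n : nat} {d : 'I_n -> nat}.
Implicit Types (X Y : tensor R d) (k : 'I_n) (Omega : {set midx d}).

Definition outer (w : forall k, 'cV[R]_(d k)) : tensor R d :=
  [ffun i : midx d => \prod_(k < n) w k (i k) 0].

Definition hadamard X Y : tensor R d := [ffun i => X i * Y i].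

Definition tpow X (alpha : R) : tensor R d := [ffun i => X i `^ alpha].

Definition tindic Omega : tensor R d := [ffun i => (i \in Omega)%:R].

Definition tnormF X : R := Num.sqrt (\sum_i X i ^+ 2).

Definition tnorm_oo X : R := \big[Num.max/0]_i `|X i|.

(* The multi-index with k-th component s and the remaining components c. *)
Definition insert k (s : 'I_(d k)) (c : cidx d k) : midx d :=
  [ffun j => match eq_comparable j k with
             | left jk => ecast l 'I_(d l) (esym jk) s
             | right jk => c (exist _ j (introN eqP jk))
             end].

Lemma insert_in k (s : 'I_(d k)) (c : cidx d k) : insert s c k = s.
Proof.
by rewrite /insert ffunE; case: eq_comparable => // kk; rewrite eq_axiomK.
Qed.

Lemma insert_out k (s : 'I_(d k)) (c : cidx d k) (j : {j | j != k}) :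
  insert s c (val j) = c j.
Proof.
rewrite /insert ffunE; case: j => j jk /=.
case: eq_comparable => [jk'|jk']; first by case/eqP: (jk).
by congr (c (exist _ j _)); exact: bool_irrelevance.
Qed.

(* The order of the columns is that of the enumeration of [cidx d k]; rank,
   spectral norm and left singular vectors do not depend on it. *)
Definition unfold k X : 'M[R]_(d k, #|{: cidx d k}|) :=
  \matrix_(s, c) X (insert s (enum_val c)).

Definition tucker_rank X k : nat := \rank (unfold k X).

(* Mode-k product with a square matrix, so that the shape is preserved. *)
Definition mode_prod X k (M : 'M[R]_(d k)) : tensor R d :=
  [ffun i : midx d => \sum_(s < d k) X (finfun (dfwith i k s)) * M s (i k)].

Definition mode_prods X (M : forall k, 'M[R]_(d k)) : tensor R d :=
  foldl (fun X' k => mode_prod X' (M k)) X (enum 'I_n).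

(* d_k + prod_(j != k) d_j *)
Definition dim_sum (k : 'I_n) : nat := (d k + \prod_(j < n | j != k) d j)%N.

(* The terms are nonnegative as soon as W is, so that 0 is neutral for the
   maxima. *)
Definition mu (W : tensor R d) Omega k : R :=
  let q i : R := (i \in Omega)%:R / W i in
  Num.sqrt
    (Num.max (\big[Num.max/0]_(s < d k) \sum_(c : cidx d k) q (insert s c))
             (\big[Num.max/0]_(c : cidx d k) \sum_(s < d k) q (insert s c))).

End Tensors.

Arguments dim_sum {n} d k.

Section Matrices.
Context {R : realType}.

Definition vnorm2 m (x : 'cV[R]_m) : R := Num.sqrt (\sum_i x i 0 ^+ 2).

Definition spectral_norm m p (A : 'M[R]_(m, p)) : R :=
  sup [set vnorm2 (A *m x) | x in [set x : 'cV[R]_p | vnorm2 x <= 1]].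

(* [s] lists the singular values; only its first [minn m p] terms matter. *)
Definition is_svd m p (A : 'M[R]_(m, p)) (U : 'M[R]_m) (s : nat -> R)
    (V : 'M[R]_p) : Prop :=
  [/\ U^T *m U = 1%:M, V^T *m V = 1%:M,
      forall i, 0 <= s i,
      forall i j, (i <= j)%N -> s j <= s i &
      A = U *m (\matrix_(i < m, j < p) (s i *+ (i == j :> nat))) *m V^T].

(* Singular vectors are not unique: any singular value decomposition may be
   used. *)
Definition first_left_singular_vectors m p r (A : 'M[R]_(m, p))
    (U : 'M[R]_(m, r)) : Prop :=
  exists (le_rm : (r <= m)%N) (U' : 'M[R]_m) (s : nat -> R) (V : 'M[R]_p),
    is_svd A U' s V /\ U = colsub (widen_ord le_rm) U'.

End Matrices.

Section Probability.
Context {R : realType} {disp : measure_display} {S : measurableType disp}.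
Context (P : probability S R).

Definition mutually_independent (I : finType) (Z : I -> {RV P >-> R}) : Prop :=
  forall (J : {set I}) (B : I -> set R), (forall i, measurable (B i)) ->
    P (\bigcap_(i in [set` J]) (Z i @^-1` B i)) =
    (\prod_(i in J) P (Z i @^-1` B i))%E.

Definition normally_distributed (m sigma : R) (Z : {RV P >-> R}) : Prop :=
  forall B : set R, measurable B -> distribution P Z B = normal_prob m sigma B.

(* The event [A], which depends on a possibly non-measurable choice of singular
   vectors, need not be measurable itself; for a measurable [A] this is
   [p <= P A]. *)
Definition with_probability_at_least (p : R) (A : set S) : Prop :=
  exists E : set S, [/\ measurable E, E `<=` A & (p%:E <= P E)%E].

Definition random_tensor n (d : 'I_n -> nat) (Z : midx d -> {RV P >-> R})
    (x : S) : tensor R d := [ffun i => Z i x].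

End Probability.

(* Main.v *)
Require Import Defs.
From HB Require Import structures.
From mathcomp Require Import all_boot all_order all_algebra.
From mathcomp Require Import all_classical all_reals all_analysis.
From mathcomp Require Import perm measurable_realfun zify ring lra.

Set Implicit Arguments.
Unset Strict Implicit.
Unset Printing Implicit Defensive.

Import Order.TTheory GRing.Theory Num.Theory.
Import numFieldNormedType.Exports.
Local Open Scope classical_set_scope.
Local Open Scope ring_scope.

(* Put X = W^(1/2) T, M = W^(-1/2) Y_Omega and E = M - X, where juxtaposition
   is entrywise; the weighted error is X - (M projected in every mode).
   Telescoping over the modes bounds it by the sum of the |(I - P_k) X_(k)|_F
   plus one |P_k E_(k)|_F; all these matrices have rank at most r_k, and
   |(I - P_k) X_(k)|_2 <= 2 |E_(k)|_2 because the (r_k + 1)-st singular value of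
   M_(k) is at most |E_(k)|_2. So the error is at most
   3 sum_k sqrt(r_k) |E_(k)|_2.

   The bias part of E_(k) is the Hadamard product of a matrix A with T_(k), and
   |A o T|_2 <= sqrt(rank T) |T|_oo |A|_2 by factoring T through a nearly
   D-optimal design on its rows (John's theorem).

   The noise part is a matrix with independent centred Gaussian entries. With H
   its Hermitian dilation, integration by parts gives
   E tr H^(2p+2) <= (2p+1) v E tr H^(2p), hence the bound D exp(v s^2 / 2) for
   E tr cosh(s H), and P(|G|_2 > t) <= D exp(-t^2 / 2v) by Markov's inequality;
   at t^2 = 4 v log D this is 1 / D. The nonzero eigenvalues of H come in pairs
   +-l, which saves the factor 2 lost in cosh(s t) >= exp(s t) / 2. *)

(** * Integration against a density *)

(** The spectral theorem never enters. Eigenvalues are replaced by traces of powers, and operator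
    norms by inequalities tested on vectors. The cosh series is truncated, so only finitely many
    trace moments occur, and integration by parts is needed only for polynomials in the Gaussian
    variables, where independence reduces it to one-dimensional moments. The obstacle in the trace
    recursion is that H does not commute with its coefficient matrices: integration by parts yields
    tr(A_i H^q A_i H^(2p-q)), with the two copies of A_i apart, and a convexity argument in q brings
    them together as tr(A_i^2 H^(2p)). The ranks stay at most r_k because W is an outer product:
    weighting T by W^(1/2) multiplies each unfolding by diagonal matrices on both sides. Probability
    enters only through the operator norms of the unfolded noise; once these are bounded, the rest
    is deterministic. *)

Section weighted_integral.
Import HBNNSimple.

(** Both sides are additive in [f] and compatible with monotone limits, so agreement on indicators
    passes to simple functions and then to [f]. It is applied with [h] the product of the remaining
    factors of an independent product, and with [X] the identity and [h] a Gaussian density. *)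
Lemma ge0_integral_weighted d1 d2 (S : measurableType d1) (T : measurableType d2)
    (R : realType) (P : {measure set S -> \bar R}) (nu : {measure set T -> \bar R})
    (X : S -> T) (h : S -> R) (c : R) (f : T -> R) :
  measurable_fun setT X -> measurable_fun setT h -> (forall x, 0 <= h x) -> 0 <= c ->
  (forall B, measurable B ->
     (\int[P]_x (\1_B (X x) * h x)%:E = c%:E * nu B)%E) ->
  measurable_fun setT f -> (forall y, 0 <= f y) ->
  (\int[P]_x (f (X x) * h x)%:E = c%:E * \int[nu]_y (f y)%:E)%E.
Proof.
move=> mX mh h0 c0 hB mf f0.
have /measurable_EFinP mEf := mf.
pose g := nnsfun_approx measurableT mEf.
have gf y : (EFin \o g^~ y) n @[n --> \oo] --> (f y)%:E.
  by apply: cvg_nnsfun_approx => // z _; rewrite lee_fin f0.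
have ndg y : {homo (fun n => g n y) : n m / (n <= m)%N >-> (n <= m)%R}.
  by move=> m n mn; exact/lefP/nd_nnsfun_approx.
have mg n : measurable_fun setT (g n) by exact: measurable_funP.
have mgX n : measurable_fun setT (fun x => g n (X x) * h x).
  by apply: measurable_funM => //; exact: measurableT_comp.
have -> : (\int[nu]_y (f y)%:E = limn (fun n => \int[nu]_y (g n y)%:E))%E.
  rewrite -monotone_convergence//.
  - by apply: eq_integral => y _; apply/esym/cvg_lim => //; exact: gf.
  - by move=> n; exact/measurable_EFinP.
  - by move=> n y _; rewrite lee_fin.
  - by move=> y _ m n mn; rewrite lee_fin; exact: ndg.
have -> : (\int[P]_x (f (X x) * h x)%:E =
           limn (fun n => \int[P]_x (g n (X x) * h x)%:E))%E.
  rewrite -monotone_convergence//.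
  - apply: eq_integral => x _; apply/esym/cvg_lim => //.
    rewrite EFinM; under eq_fun do rewrite EFinM.
    by apply: cvgeZr => //; exact: gf.
  - by move=> n; exact/measurable_EFinP.
  - by move=> n y _; rewrite lee_fin mulr_ge0.
  - by move=> y _ m n mn; rewrite lee_fin ler_wpM2r//; exact: ndg.
have eqn n : (\int[P]_x (g n (X x) * h x)%:E = c%:E * \int[nu]_y (g n y)%:E)%E.
  have fg : finite_set (range (g n)) by exact: fimfunP.
  have mB r : measurable (g n @^-1` [set r]) by exact: measurable_sfunP.
  have rg r : r \in range (g n) -> 0 <= r by rewrite inE => -[y _ <-].
  transitivity (\sum_(r \in range (g n)) (r%:E * (c%:E * nu (g n @^-1` [set r]))))%E.
    transitivity (\int[P]_x (\sum_(r \in range (g n))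
        (r * (\1_(g n @^-1` [set r]) (X x) * h x))%:E))%E.
      apply: eq_integral => x _; rewrite (fimfunE (g n)) fsumEFin//.
      congr EFin; rewrite (fsbig_finite _ _ fg)/= (fsbig_finite _ _ fg)/= mulr_suml.
      by apply: eq_bigr => r _; rewrite mulrA.
    rewrite (fsbig_finite _ _ fg)/=.
    under eq_integral do rewrite fsumEFin// (fsbig_finite _ _ fg)/= -sumEFin.
    rewrite ge0_integral_sum//=; last 2 first.
    - move=> r; apply/measurable_EFinP/measurable_funM => //.
      apply: measurable_funM => //.
      by apply: (@measurableT_comp _ _ _ _ _ _ (\1_(g n @^-1` [set r]) : T -> R)).
    - move=> r x _; rewrite mulrA EFinM mule_ge0// ?lee_fin//.
      by have := nnfun_muleindic_ge0 (g n) r (X x); rewrite -EFinM lee_fin.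
    apply: eq_big_seq => r; rewrite in_fset_set// inE => -[y _ <-].
    under eq_integral do rewrite EFinM.
    rewrite ge0_integralZl//; first by rewrite hB.
    - apply/measurable_EFinP/measurable_funM => //.
      by apply: (@measurableT_comp _ _ _ _ _ _ (\1_(g n @^-1` [set g n y]) : T -> R)).
    - by move=> x _; rewrite lee_fin mulr_ge0// indicE.
    - by rewrite lee_fin.
  transitivity (c%:E * \int[nu]_y (\sum_(r \in range (g n))
        (r * \1_(g n @^-1` [set r]) y)%:E))%E; last first.
    by congr (_ * _)%E; apply: eq_integral => y _; rewrite fsumEFin// -fimfunE.
  under eq_integral do rewrite fsumEFin// (fsbig_finite _ _ fg)/= -sumEFin.
  rewrite ge0_integral_sum//=; last 2 first.
  - by move=> r; apply/measurable_EFinP/measurable_funM.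
  - by move=> r y _; have := nnfun_muleindic_ge0 (g n) r y; rewrite -EFinM.
  rewrite (fsbig_finite _ _ fg)/= ge0_sume_distrr; last first.
    move=> r _; apply: integral_ge0 => y _.
    by have := nnfun_muleindic_ge0 (g n) r y; rewrite -EFinM.
  apply: eq_big_seq => r; rewrite in_fset_set// inE => -[y _ <-].
  under [in RHS]eq_integral do rewrite EFinM.
  rewrite ge0_integralZl//; first by rewrite integral_indic// setIT muleCA.
  - by apply/measurable_EFinP.
  - by rewrite lee_fin.
under eq_fun do rewrite eqn.
apply: cvg_lim => //; apply: cvgeZl => //.
apply: ereal_nondecreasing_is_cvgn => m n mn.
apply: ge0_le_integral => //.
- by move=> y _; rewrite lee_fin.
- by apply/measurable_EFinP.
- by apply/measurable_EFinP.
- by move=> y _; rewrite lee_fin; exact: ndg.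
Qed.

End weighted_integral.

(** * Independent random variables *)

Section independence.
Context {R : realType} {disp : measure_display} {S : measurableType disp}.
Context (P : probability S R) (I : finType) (Z : I -> {RV P >-> R}).
Hypothesis Z_indep : mutually_independent Z.

Let measurable_comp_RV (f : R -> R) i :
  measurable_fun setT f -> measurable_fun setT (f \o Z i).
Proof. by move=> mf; exact: measurableT_comp. Qed.

Lemma expectation_prod_indic (B : I -> set R) : (forall i, measurable (B i)) ->
  (\int[P]_x (\prod_i \1_(B i) (Z i x))%:E =
   (\prod_i \int[P]_x \1_(B i) (Z i x))%:E)%E.
Proof.
move=> mB.
have mZB i : measurable (Z i @^-1` B i) by exact: measurable_funPTI.
have -> : \prod_i \int[P]_x (\1_(B i) (Z i x) : R) =
    \prod_i fine (P (Z i @^-1` B i)).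
  apply: eq_bigr => i _; congr fine.
  by rewrite (_ : (fun x => _) = EFin \o \1_(Z i @^-1` B i))// integral_indic// setIT.
rewrite -prodEFin; under [RHS]eq_bigr do rewrite fineK ?fin_num_measure//.
have := Z_indep [set: I]%SET mB.
under [in RHS]eq_bigl do rewrite inE.
move=> <-.
have -> : (fun x => (\prod_i (\1_(B i) (Z i x) : R))%:E) =
    EFin \o \1_(\bigcap_(i in [set` [set: I]%SET]) (Z i @^-1` B i)).
  apply/funext => x /=; congr EFin; rewrite indicE.
  have [xB|/negP xB] := boolP (x \in _).
    apply: big1 => i _; rewrite indicE mem_set//.
    by move/set_mem : xB => /(_ i); apply; rewrite /= inE.
  apply/eqP/prodf_eq0; apply: contrapT => h; apply: xB; apply/mem_set => i _ /=.
  by apply: contrapT => nB; apply: h; exists i => //; rewrite indicE memNset.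
rewrite integral_indic ?setIT//.
by apply: fin_bigcap_measurable => //; exact: finite_finset.
Qed.

(** Independence is the product formula for indicators. The factors are released from being
    indicators one at a time, by [ge0_integral_weighted] with the product of the other factors as
    weight. *)
Lemma expectation_prod_ge0 (f : I -> R -> R) :
  (forall i, measurable_fun setT (f i)) -> (forall i y, 0 <= f i y) ->
  (forall i, P.-integrable setT (fun x => (f i (Z i x))%:E)) ->
  (\int[P]_x (\prod_i f i (Z i x))%:E =
   (\prod_i \int[P]_x f i (Z i x))%:E)%E.
Proof.
(* [K] lists the indices whose factor may be something other than an indicator. *)
have ind (K : seq I) : forall f : I -> R -> R,
    (forall i, i \notin K -> exists2 B, measurable B & f i = \1_B) ->
    (forall i, measurable_fun setT (f i)) -> (forall i y, 0 <= f i y) ->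
    (forall i, P.-integrable setT (fun x => (f i (Z i x))%:E)) ->
    (\int[P]_x (\prod_i f i (Z i x))%:E =
      (\prod_i \int[P]_x f i (Z i x))%:E)%E.
  elim: K => [|k K IH] {}f fB mf f0 intf.
    have /choice[B HB] : forall i, exists B, measurable B /\ f i = \1_B.
      by move=> i; have [//|B mB ->] := fB i; exists B.
    have -> : f = fun i => \1_(B i) by apply/funext => i; case: (HB i).
    by apply: expectation_prod_indic => i; case: (HB i).
  pose h x := \prod_(i | i != k) f i (Z i x).
  pose c := \prod_(i | i != k) \int[P]_x f i (Z i x).
  have mh : measurable_fun setT h.
    rewrite /h; under eq_fun do rewrite big_mkcond.
    apply: measurable_prod => i _; case: (i != k) => //.
    exact: measurable_comp_RV.
  have h0 x : 0 <= h x by apply: prodr_ge0 => i _.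
  have c0 : 0 <= c by apply: prodr_ge0 => i _; exact: Rintegral_ge0.
  transitivity (\int[P]_x (f k (Z k x) * h x)%:E)%E.
    by apply: eq_integral => x _; rewrite (bigD1 k).
  have wE := @ge0_integral_weighted _ _ _ _ _ P (distribution P (Z k)) (Z k) h c (f k).
  rewrite wE//.
    rewrite ge0_integral_distribution//; last 2 first.
    - by apply/measurable_EFinP.
    - by move=> y; rewrite lee_fin.
    rewrite (bigD1 k)//= EFinM muleC /Rintegral fineK//.
    exact: integrable_fin_num.
  (* What remains is the same formula with [f k] replaced by an indicator, which is the induction
     hypothesis. *)
  move=> B mB.
  pose f' i := if i == k then \1_B else f i.
  transitivity (\int[P]_x (\prod_i f' i (Z i x))%:E)%E.
    apply: eq_integral => x _; rewrite (bigD1 k)//= {1}/f' eqxx; congr (_ * _)%:E.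
    by apply: eq_bigr => i /negbTE ik; rewrite /f' ik.
  rewrite IH.
  - rewrite (bigD1 k)//= EFinM muleC {2}/f' eqxx; congr (_ * _)%E.
      by congr EFin; apply: eq_bigr => i /negbTE ik; rewrite /f' ik.
    have mZB : measurable (Z k @^-1` B) by exact: measurable_funPTI.
    rewrite /Rintegral (_ : (fun x => _) = EFin \o \1_(Z k @^-1` B))//.
    by rewrite integral_indic// setIT fineK ?fin_num_measure.
  - move=> i iK; rewrite /f'; case: eqVneq => ik; first by exists B.
    by apply: fB; rewrite inE negb_or ik.
  - by move=> i; rewrite /f'; case: ifP.
  - by move=> i y; rewrite /f'; case: ifP => // _; rewrite indicE.
  - move=> i; rewrite /f'; case: eqP => // _.
    have mZB : measurable (Z i @^-1` B) by exact: measurable_funPTI.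
    exact: (integrable_indic P mZB).
move=> mf f0 intf; apply: (ind (enum I)) => // i.
by rewrite mem_enum.
Qed.

Lemma integrable_prod_indep (f : I -> R -> R) :
  (forall i, measurable_fun setT (f i)) ->
  (forall i, P.-integrable setT (fun x => (f i (Z i x))%:E)) ->
  P.-integrable setT (fun x => (\prod_i f i (Z i x))%:E).
Proof.
move=> mf intf.
have mprod : measurable_fun setT (fun x => \prod_i f i (Z i x)).
  by apply: measurable_prod => i _; exact: measurable_comp_RV.
apply/integrableP; split; first exact/measurable_EFinP.
under eq_integral do rewrite /= normr_prod.
rewrite (@expectation_prod_ge0 (fun i y => `|f i y|)) ?ltry//.
- by move=> i; exact: measurableT_comp.
- by move=> i; exact: (integrable_norm (intf i)).
Qed.

(** The formula is linear in each factor, so signed factors can be split into positive and negative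
    parts one at a time, down to the nonnegative case. *)
Lemma expectation_prod_indep (f : I -> R -> R) :
  (forall i, measurable_fun setT (f i)) ->
  (forall i, P.-integrable setT (fun x => (f i (Z i x))%:E)) ->
  \int[P]_x (\prod_i f i (Z i x)) = \prod_i \int[P]_x f i (Z i x).
Proof.
have ind (K : seq I) : forall f : I -> R -> R,
    (forall i, i \notin K -> forall y, 0 <= f i y) ->
    (forall i, measurable_fun setT (f i)) ->
    (forall i, P.-integrable setT (fun x => (f i (Z i x))%:E)) ->
    \int[P]_x (\prod_i f i (Z i x)) = \prod_i \int[P]_x f i (Z i x).
  elim: K => [|k K IH] {}f f0 mf intf.
    by rewrite {1}/Rintegral expectation_prod_ge0// => i y; exact: f0.
  pose g (u : R -> R) i := if i == k then u else f i.
  have gE (u : R -> R) : (forall y, 0 <= u y) -> measurable_fun setT u ->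
      P.-integrable setT (fun x => (u (Z k x))%:E) ->
      P.-integrable setT (fun x => (u (Z k x) * \prod_(i | i != k) f i (Z i x))%:E) /\
      \int[P]_x (u (Z k x) * \prod_(i | i != k) f i (Z i x)) =
      \int[P]_x u (Z k x) * \prod_(i | i != k) \int[P]_x f i (Z i x).
    move=> u0 mu iu.
    have -> : (fun x => u (Z k x) * \prod_(i | i != k) f i (Z i x)) =
       fun x => \prod_i g u i (Z i x).
      apply/funext => x; rewrite [RHS](bigD1 k)//= {1}/g eqxx; congr (_ * _).
      by apply: eq_bigr => i /negbTE ik; rewrite /g ik.
    have -> : (fun x => (u (Z k x) * \prod_(i | i != k) f i (Z i x))%:E) =
       fun x => (\prod_i g u i (Z i x))%:E.
      apply/funext => x; rewrite [in RHS](bigD1 k)//= {1}/g eqxx; congr (_ * _)%:E.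
      by apply: eq_bigr => i /negbTE ik; rewrite /g ik.
    have mg i : measurable_fun setT (g u i) by rewrite /g; case: ifP.
    have ig i : P.-integrable setT (fun x => (g u i (Z i x))%:E).
      by rewrite /g; case: eqP => // ->.
    split; first exact: integrable_prod_indep.
    rewrite IH//.
      rewrite (bigD1 k)//= {1}/g eqxx; congr (_ * _).
      by apply: eq_bigr => i /negbTE ik; rewrite /g ik.
    move=> i iK y; rewrite /g; case: eqVneq => // ik.
    by apply: f0; rewrite inE negb_or ik.
  have [|||ip ep] := gE (fun y => Num.max (f k y) 0).
  - by move=> y; rewrite le_max lexx orbT.
  - exact: (measurable_funrpos (mf k)).
  - exact: (integrable_funrpos measurableT (intf k)).
  have [|||im em] := gE (fun y => Num.max (- f k y) 0).
  - by move=> y; rewrite le_max lexx orbT.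
  - exact: (measurable_funrneg (mf k)).
  - exact: (integrable_funrneg measurableT (intf k)).
  have maxE y : f k y = Num.max (f k y) 0 - Num.max (- f k y) 0.
    by case: (leP 0 (f k y)) => fy; case: (leP 0 (- f k y)) => fy'; lra.
  rewrite (bigD1 k)//=.
  under eq_Rintegral do rewrite (bigD1 k)//= maxE mulrBl.
  rewrite RintegralB// ep em -mulrBl; congr (_ * _).
  rewrite -RintegralB//; last 2 first.
  - exact: (integrable_funrpos measurableT (intf k)).
  - exact: (integrable_funrneg measurableT (intf k)).
  by apply: eq_Rintegral => x _; rewrite -maxE.
move=> mf intf; apply: (ind (enum I)) => // i.
by rewrite mem_enum.
Qed.
End independence.

(** * Moments of the normal distribution *)

Section normal_moments.
Context {R : realType} (sigma : R).
Hypothesis sigma_gt0 : 0 < sigma.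
Local Notation leb := (@lebesgue_measure R).
Local Notation phi := (normal_pdf 0 sigma).

Lemma expr_le_expR (a : nat) (u : R) : 0 <= u -> u ^+ a <= a%:R ^+ a * expR u.
Proof.
move=> u0; case: a => [|a]; first by rewrite !expr0 mul1r -expR0 ler_expR.
have a0 : (0 : R) < a.+1%:R by [].
have -> : u = a.+1%:R * (u / a.+1%:R) by rewrite mulrCA divff ?mulr1// gt_eqF.
rewrite exprMn expRM_natl ler_wpM2l ?exprn_ge0//.
rewrite lerXn2r ?nnegrE ?expR_ge0 ?divr_ge0//.
by rewrite (le_trans _ (expR_ge1Dx _))// lerDr.
Qed.

Let sg0 : sigma != 0. Proof. by rewrite gt_eqF. Qed.

(** Doubling the standard deviation leaves a factor exp(-u) with u = 3 x^2 / (8 sigma^2), which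
    absorbs any power of x. The bound gives integrability and makes boundary terms vanish. *)
Lemma expr_normal_pdf_le (a : nat) : exists2 C : R, 0 <= C &
  forall x, `|x ^+ a * phi x| <= C * normal_pdf 0 (2 * sigma) x.
Proof.
have s20 : 2 * sigma != 0 by rewrite mulf_neq0.
pose c : R := 8 * sigma ^+ 2 / 3.
have c0 : 0 <= c by rewrite divr_ge0// mulr_ge0// sqr_ge0.
pose K : R := 1 + c ^+ a * a%:R ^+ a.
have K0 : 0 <= K by rewrite addr_ge0// mulr_ge0// exprn_ge0.
exists (normal_peak sigma / normal_peak (2 * sigma) * K).
  by rewrite mulr_ge0// divr_ge0// normal_peak_ge0.
move=> x; rewrite !normal_pdfE// normrM [X in _ * X]ger0_norm; last first.
  by rewrite mulr_ge0 ?normal_peak_ge0 ?normal_fun_ge0.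
rewrite [leRHS](_ : _ = normal_peak sigma * (K * normal_fun 0 (2 * sigma) x)); last first.
  field; rewrite gt_eqF// normal_peak_gt0//.
rewrite mulrCA ler_wpM2l ?normal_peak_ge0//.
pose u := 3 * x ^+ 2 / (8 * sigma ^+ 2).
have u0 : 0 <= u by rewrite /u divr_ge0// mulr_ge0// sqr_ge0.
have -> : normal_fun 0 sigma x = normal_fun 0 (2 * sigma) x * expR (- u).
  rewrite /normal_fun -expRD; congr expR; rewrite /u; field.
  by rewrite sg0.
rewrite mulrCA [K * _]mulrC ler_wpM2l ?normal_fun_ge0//.
rewrite expRN ler_pdivrMr ?expR_gt0//.
have : `|x ^+ a| <= 1 + (x ^+ 2) ^+ a.
  rewrite exprAC -[X in _ <= 1 + X]real_normK ?num_real//; set t := `|_|.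
  have : 0 <= t by exact: normr_ge0.
  by nra.
move/le_trans; apply; rewrite /K mulrDl mul1r lerD//.
  by rewrite -expR0 ler_expR.
have -> : x ^+ 2 = c * u by rewrite /u /c; field; rewrite sg0.
by rewrite exprMn -mulrA ler_wpM2l ?expr_le_expR// exprn_ge0.
Qed.

Lemma integrable_expr_normal_pdf (a : nat) :
  leb.-integrable setT (fun x => (x ^+ a * phi x)%:E).
Proof.
have [C C0 HC] := expr_normal_pdf_le a.
apply: (@le_integrable _ _ _ leb _ measurableT _
   (fun x => C%:E * (normal_pdf 0 (2 * sigma) x)%:E)%E).
- apply/measurable_EFinP/measurable_funM; last exact: measurable_normal_pdf.
  exact: exprn_measurable.
- move=> x _; rewrite lee_fin (le_trans (HC x))// ler_norm//.
- by apply: integrableZl => //; exact: integrable_normal_pdf.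
Qed.

Lemma is_derive_normal_pdf (x : R) :
  is_derive x 1 phi (- (x / sigma ^+ 2) * phi x).
Proof.
have -> : phi = normal_peak sigma \*: (expR \o ((- (sigma ^+ 2 *+ 2)^-1) \*: (fun y : R => y) ^+ 2)).
  apply/funext => y; rewrite normal_pdfE// /normal_fun /=; congr (_ * expR _).
  by rewrite subr0 /= fctE /GRing.scale /=; field.
apply: is_derive_eq.
rewrite /GRing.scale /= /GRing.scale/=.
rewrite !fctE; field.
by [].
Qed.

(** The difference of the two integrands is the derivative of -sigma^2 x^a phi(x), which vanishes at
    both infinities. For a = 0 the truncated [a.-1] is multiplied by 0. *)
Lemma normal_moment_rec (a : nat) :
  \int[leb]_x (x ^+ a.+1 * phi x) = sigma ^+ 2 * a%:R * \int[leb]_x (x ^+ a.-1 * phi x).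
Proof.
pose f (x : R) := x ^+ a.+1 * phi x - sigma ^+ 2 * a%:R * (x ^+ a.-1 * phi x).
have intZ : leb.-integrable setT (fun x => (sigma ^+ 2 * a%:R * (x ^+ a.-1 * phi x))%:E).
  have := integrableZl measurableT (sigma ^+ 2 * a%:R) (integrable_expr_normal_pdf a.-1).
  by under eq_fun do rewrite -EFinM.
have intf : leb.-integrable setT (fun x => (f x)%:E).
  by have := integrableB measurableT (integrable_expr_normal_pdf a.+1) intZ; exact.
suff f0 : (\int[leb]_x (f x)%:E = 0)%E.
  apply/eqP; rewrite -subr_eq0 -RintegralZl//; last exact: integrable_expr_normal_pdf.
  rewrite -RintegralB//; last exact: integrable_expr_normal_pdf.
  by rewrite /Rintegral f0.
pose F : R -> R := (- sigma ^+ 2) \*: ((fun y : R => y) ^+ a * phi).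
have dF (x : R) : is_derive x (1 : R) F (f x).
  have ? := is_derive_normal_pdf x.
  apply: is_derive_eq.
  rewrite /f /= /GRing.scale /= !fctE.
  case: (a) => [|b] /=; rewrite ?expr0 ?mulr0n ?exprS; field; by [].
have cf : continuous f.
  move=> x; apply: cvgB; apply: cvgM => //; try exact: cvg_cst.
  - exact: exprn_continuous.
  - exact: continuous_normal_pdf.
  - by apply: cvgM; [exact: exprn_continuous|exact: continuous_normal_pdf].
have cF : continuous F.
  move=> x; apply: differentiable_continuous; apply/derivable1_diffP.
  by have [] := dF x.
pose I (n : nat) : set R := [set` `[- n.+1%:R, n.+1%:R]].
have FTC n : (\int[leb]_(x in I n) (f x)%:E = (F n.+1%:R - F (- n.+1%:R))%:E)%E.
  rewrite EFinB; apply: continuous_FTC2.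
  - by rewrite gtrN.
  - by apply: continuous_subspaceT => x; exact: cf.
  - split.
    + by move=> x _; have [] := dF x.
    + exact: cvg_at_right_filter (cF _).
    + exact: cvg_at_left_filter (cF _).
  - by move=> x _; rewrite derive1E; have [_ ->] := dF x.
have lim1 : (\int[leb]_(x in I n) (f x)%:E)%E @[n --> \oo] --> (\int[leb]_x (f x)%:E)%E.
  under eq_fun do rewrite integral_mkcond.
  have [|||||_ _ //] := @dominated_convergence _ _ _ leb setT measurableT
    (fun n => (fun x => (f x)%:E) \_ (I n)) (fun x => (f x)%:E) (fun x => `|(f x)%:E|%E).
  - move=> n; apply/(measurable_restrictT _ _).1 => //; first exact: measurable_itv.
    exact: measurable_funS (measurable_int _ intf).
  - exact: measurable_int intf.
  - apply: aeW => x _; apply: cvg_near_cst; near=> n.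
    rewrite patchE mem_set// /I /= in_itv /= -ler_norml.
    apply: le_trans (_ : n%:R <= _); last by rewrite ler_nat.
    by near: n; exact: nbhs_infty_ger.
  - exact: integrable_abse.
  - by apply: aeW => x n _; rewrite patchE; case: ifP => //; rewrite abse0 abse_ge0.
have lim2 : (F n.+1%:R - F (- n.+1%:R))%:E @[n --> \oo] --> (0 : \bar R)%E.
  apply: cvg_EFin; first by near=> n.
  have [C C0 HC] := expr_normal_pdf_le a.
  pose K := sigma ^+ 2 * (C * (normal_peak (2 * sigma) * (8 * sigma ^+ 2))).
  (* The decay comes from exp(u) > u at u = x^2 / (8 sigma^2), together with x^2 >= |x| in this
     range. *)
  have FK (x : R) : 1 <= `|x| -> `|F x| <= K * `|x|^-1.
    move=> x1.
    have -> : F x = - (sigma ^+ 2 * (x ^+ a * phi x)).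
      by rewrite /F /= /GRing.scale /= !fctE mulNr.
    have -> : K * `|x|^-1 =
        sigma ^+ 2 * (C * (normal_peak (2 * sigma) * (8 * sigma ^+ 2 * `|x|^-1))).
      by rewrite /K !mulrA.
    rewrite normrN normrM (ger0_norm (sqr_ge0 _)); apply: (ler_wpM2l (sqr_ge0 _)).
    apply: le_trans (HC x) _; rewrite ler_wpM2l//.
    rewrite normal_pdfE ?mulf_neq0// ler_wpM2l ?normal_peak_ge0//.
    have s20 : 0 < 8 * sigma ^+ 2 by rewrite mulr_gt0// exprn_gt0.
    have x0 : 0 < `|x| by rewrite (lt_le_trans ltr01).
    have px : 0 < 8 * sigma ^+ 2 * `|x|^-1 by rewrite mulr_gt0// invr_gt0.
    rewrite -lef_pV2 ?posrE ?expR_gt0//.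
    rewrite /normal_fun subr0 mulNr expRN invrK invfM invrK.
    have -> : x ^+ 2 / ((2 * sigma) ^+ 2 *+ 2) = `|x| ^+ 2 / (8 * sigma ^+ 2).
      by rewrite real_normK ?num_real//; field.
    apply: le_trans (ltW (expR_gt1Dx _)); last first.
      by rewrite gt_eqF// divr_gt0// exprn_gt0// (lt_le_trans ltr01).
    apply: le_trans (_ : `|x| ^+ 2 / (8 * sigma ^+ 2) <= _); last by rewrite lerDr.
    rewrite [leLHS]mulrC; apply: ler_wpM2r; first by rewrite invr_ge0 ltW.
    by rewrite -[leLHS]mulr1 [leRHS]expr2 ler_wpM2l.
  apply/norm_cvg0P.
  have K0 : 0 <= K.
    by rewrite mulr_ge0 ?sqr_ge0// mulr_ge0// mulr_ge0 ?normal_peak_ge0// mulr_ge0// sqr_ge0.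
  apply: (@squeeze_cvgr _ _ _ _ (fun=> 0) (fun n => (K + K) * harmonic n)).
  - near=> n; rewrite normr_ge0 /= (le_trans (ler_normB _ _))// mulrDl lerD//.
      by rewrite (le_trans (FK _ _))// ger0_norm// ler1n.
    by rewrite (le_trans (FK _ _))// normrN ger0_norm// ler1n.
  - exact: cvg_cst.
  - rewrite -[X in _ --> X](mulr0 (K + K)); apply: cvgM; [exact: cvg_cst|exact: cvg_harmonic].
move: lim1; under eq_fun do rewrite FTC.
by move=> lim1; apply: cvg_unique lim1 lim2.
Unshelve. all: by end_near.
Qed.
End normal_moments.

(** * Gaussian integration by parts *)

Section gaussian_family.
Context {R : realType} {disp : measure_display} {S : measurableType disp}.
Context (P : probability S R) (I : finType) (Z : I -> {RV P >-> R}).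
Context (sigma : R).
Hypothesis sigma_gt0 : 0 < sigma.
Hypothesis Z_indep : mutually_independent Z.
Hypothesis Z_normal : forall i, normally_distributed 0 sigma (Z i).
Local Notation leb := (@lebesgue_measure R).
Local Notation phi := (normal_pdf 0 sigma).

Lemma ge0_expectation_normal i (f : R -> R) :
  measurable_fun setT f -> (forall y, 0 <= f y) ->
  (\int[P]_x (f (Z i x))%:E = \int[leb]_y (f y * phi y)%:E)%E.
Proof.
move=> mf f0.
have E := @ge0_integral_weighted _ _ _ _ _ leb (distribution P (Z i)) id phi 1 f.
have D : (\int[P]_x (f (Z i x))%:E = \int[distribution P (Z i)]_y (f y)%:E)%E.
  have mEf : measurable_fun setT (EFin \o f) by exact/measurable_EFinP.
  have Ef0 y : (0 <= (EFin \o f) y)%E by rewrite lee_fin.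
  by rewrite (ge0_integral_distribution (Z i) mEf Ef0).
rewrite D -[LHS]mul1e; apply/esym/E => //.
- exact: measurable_normal_pdf.
- by move=> y; exact: normal_pdf_ge0.
- move=> B mB; rewrite mul1e [RHS](Z_normal i mB) /normal_prob [RHS]integral_mkcond.
  apply: eq_integral => y _; rewrite patchE indicE.
  by case: ifPn => yB; rewrite ?mul1r ?mul0r.
Qed.

Lemma integrable_normalX i (a : nat) :
  P.-integrable setT (fun x => (Z i x ^+ a)%:E).
Proof.
apply/integrableP; split.
  apply/measurable_EFinP; apply: (measurableT_comp (exprn_measurable _)) => //.
rewrite /= (@ge0_expectation_normal i (fun y => `|y ^+ a|))//; last first.
  by apply: measurableT_comp => //; exact: exprn_measurable.
have /integrableP[_] := integrable_expr_normal_pdf sigma_gt0 a.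
congr (_ < _)%E; apply: eq_integral => x _ /=; congr EFin.
by rewrite normrM (ger0_norm (normal_pdf_ge0 _ _ _)).
Qed.

Definition normal_moment (a : nat) : R := \int[leb]_y (y ^+ a * phi y).

Lemma expectation_normalX i (a : nat) :
  \int[P]_x (Z i x ^+ a) = normal_moment a.
Proof.
have mX : measurable_fun setT (fun y : R => y ^+ a) by exact: exprn_measurable.
have split (r : R) : r = Num.max r 0 - Num.max (- r) 0.
  by case: (leP 0 r) => fy; case: (leP 0 (- r)) => fy'; lra.
have ip := integrable_funrpos measurableT (integrable_normalX i a).
have im := integrable_funrneg measurableT (integrable_normalX i a).
have iX := integrable_expr_normal_pdf sigma_gt0 a.
have lp := integrable_funrpos measurableT iX.
have lm := integrable_funrneg measurableT iX.
have phi0 y : 0 <= phi y by exact: normal_pdf_ge0.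
rewrite /normal_moment.
under eq_Rintegral => x _ do rewrite (split (Z i x ^+ a)).
under [RHS]eq_Rintegral => y _ do rewrite (split (y ^+ a * phi y)).
rewrite RintegralB// RintegralB//; congr (_ - _); congr fine.
- rewrite (@ge0_expectation_normal i (fun y => Num.max (y ^+ a) 0))//.
  + by apply: eq_integral => y _; rewrite maxr_pMl// mul0r.
  + exact: (measurable_funrpos mX).
  + by move=> y; rewrite le_max lexx orbT.
- rewrite (@ge0_expectation_normal i (fun y => Num.max (- y ^+ a) 0))//.
  + by apply: eq_integral => y _; rewrite maxr_pMl// mul0r mulNr.
  + exact: (measurable_funrneg mX).
  + by move=> y; rewrite le_max lexx orbT.
Qed.

Definition monomial (e : I -> nat) (x : S) : R := \prod_i Z i x ^+ e i.
Definition incr (e : I -> nat) j : I -> nat := fun i => (e i + (i == j))%N.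
Definition decr (e : I -> nat) j : I -> nat := fun i => (e i - (i == j))%N.

Lemma monomial_incr e j x : monomial (incr e j) x = Z j x * monomial e x.
Proof.
rewrite /monomial (bigD1 j)//= [in RHS](bigD1 j)//= /incr eqxx addn1 exprS mulrA.
by congr (_ * _); apply: eq_bigr => i /negbTE ->; rewrite addn0.
Qed.

Lemma incrK e j : decr (incr e j) j = e.
Proof. by apply/funext => i; rewrite /decr /incr addnK. Qed.

Lemma decrK e j : (0 < e j)%N -> incr (decr e j) j = e.
Proof.
move=> ej; apply/funext => i; rewrite /decr /incr.
by case: eqVneq => [->|_]; rewrite ?subnK// addn0 subn0.
Qed.

Lemma incr_decr e i j : i != j -> decr (incr e j) i = incr (decr e i) j.
Proof.
move=> ij; apply/funext => k; rewrite /decr /incr.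
case: (eqVneq k j) => [->|]; last by rewrite !addn0.
by rewrite eq_sym (negbTE ij) !subn0.
Qed.

Lemma integrable_monomial e : P.-integrable setT (fun x => (monomial e x)%:E).
Proof.
apply: (integrable_prod_indep Z_indep (f := fun i y => y ^+ e i)) => i.
  exact: exprn_measurable.
exact: integrable_normalX.
Qed.

Lemma expectation_monomial e :
  \int[P]_x monomial e x = \prod_i normal_moment (e i).
Proof.
rewrite (expectation_prod_indep Z_indep (f := fun i y => y ^+ e i)).
- by apply: eq_bigr => i _; exact: expectation_normalX.
- by move=> i; exact: exprn_measurable.
- by move=> i; exact: integrable_normalX.
Qed.

(** By independence both sides share all factors except that of [Z i], where the claim is the
    recursion between the moments of orders e_i + 1 and e_i - 1. *)
Lemma monomial_by_parts e i : \int[P]_x (Z i x * monomial e x) =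
  sigma ^+ 2 * ((e i)%:R * \int[P]_x monomial (decr e i) x).
Proof.
under eq_Rintegral do rewrite -monomial_incr.
rewrite !expectation_monomial (bigD1 i)//= [in RHS](bigD1 i)//= /incr /decr eqxx.
rewrite addn1 subn1 /normal_moment normal_moment_rec// !mulrA; congr (_ * _).
by apply: eq_bigr => j /negbTE ->; rewrite addn0 subn0.
Qed.

(* Quantifying over the monomial makes the property stable under multiplication
   by a [Z j]. The truncated subtraction in [decr] is harmless, since the term
   carries the factor [e i]. *)
Definition by_parts (F : S -> R) (DF : I -> S -> R) : Prop := forall e,
  [/\ P.-integrable setT (fun x => (monomial e x * F x)%:E),
      forall i, P.-integrable setT (fun x => (monomial e x * DF i x)%:E) &
      forall i, \int[P]_x (Z i x * (monomial e x * F x)) =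
        sigma ^+ 2 * ((e i)%:R * \int[P]_x (monomial (decr e i) x * F x)
                      + \int[P]_x (monomial e x * DF i x))].

Lemma by_parts_cst (c : R) : by_parts (fun=> c) (fun _ _ => 0).
Proof.
have im e : P.-integrable setT (fun x => (monomial e x * c)%:E).
  have := integrableZr measurableT c (integrable_monomial e).
  by under eq_fun do rewrite -EFinM.
move=> e; split => // [i|i].
  by under eq_fun do rewrite mulr0; exact: integrable0.
under eq_Rintegral do rewrite mulrA.
rewrite RintegralZr//; last first.
  by have := integrable_monomial (incr e i); under eq_fun do rewrite monomial_incr.
rewrite monomial_by_parts RintegralZr//; last exact: integrable_monomial.
under [X in _ + X]eq_Rintegral do rewrite mulr0.
by rewrite Rintegral_cst// mul0r addr0 !mulrA.
Qed.

Let integrableDR (F G : S -> R) : P.-integrable setT (fun x => (F x)%:E) ->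
  P.-integrable setT (fun x => (G x)%:E) ->
  P.-integrable setT (fun x => (F x + G x)%:E).
Proof.
by move=> iF iG; have := integrableD measurableT iF iG; exact.
Qed.

Let integrableZR (c : R) (F : S -> R) : P.-integrable setT (fun x => (F x)%:E) ->
  P.-integrable setT (fun x => (c * F x)%:E).
Proof.
by move=> iF; have := integrableZl measurableT c iF; under eq_fun do rewrite -EFinM.
Qed.

Let by_parts_integrableZ F DF e i : by_parts F DF ->
  P.-integrable setT (fun x => (Z i x * (monomial e x * F x))%:E).
Proof.
move=> /(_ (incr e i))[+ _ _]; under eq_fun do rewrite monomial_incr -mulrA.
by [].
Qed.

Lemma by_partsD F DF G DG : by_parts F DF -> by_parts G DG ->
  by_parts (fun x => F x + G x) (fun i x => DF i x + DG i x).
Proof.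
move=> HF HG e; have [iF iDF eF] := HF e; have [iG iDG eG] := HG e.
split => [|i|i].
- under eq_fun do rewrite mulrDr; exact: integrableDR.
- under eq_fun do rewrite mulrDr; exact: integrableDR.
- have [iF' _ _] := HF (decr e i); have [iG' _ _] := HG (decr e i).
  under eq_Rintegral do rewrite mulrDr mulrDr.
  under [X in _ * (_ * X + _)]eq_Rintegral do rewrite mulrDr.
  under [X in _ * (_ + X)]eq_Rintegral do rewrite mulrDr.
  have zF := by_parts_integrableZ e i HF; have zG := by_parts_integrableZ e i HG.
  rewrite !RintegralD//; [|exact: iDF|exact: iDG].
  rewrite eF eG; ring.
Qed.

Lemma by_partsZ (c : R) F DF : by_parts F DF ->
  by_parts (fun x => c * F x) (fun i x => c * DF i x).
Proof.
move=> HF e; have [iF iDF eF] := HF e.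
split => [|i|i].
- under eq_fun do rewrite mulrCA; exact: integrableZR.
- under eq_fun do rewrite mulrCA; exact: integrableZR.
- have [iF' _ _] := HF (decr e i).
  under eq_Rintegral do rewrite (mulrCA _ c) (mulrCA _ c).
  under [X in _ * (_ * X + _)]eq_Rintegral do rewrite mulrCA.
  under [X in _ * (_ + X)]eq_Rintegral do rewrite mulrCA.
  have zF := by_parts_integrableZ e i HF.
  rewrite !RintegralZl//; last exact: iDF.
  rewrite eF; ring.
Qed.

Lemma by_parts_sum (J : Type) (s : seq J) (F : J -> S -> R) (DF : J -> I -> S -> R) :
  (forall j, by_parts (F j) (DF j)) ->
  by_parts (fun x => \sum_(j <- s) F j x) (fun i x => \sum_(j <- s) DF j i x).
Proof.
move=> HF; elim: s => [|j s IH].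
  have -> : (fun x => \sum_(j <- [::]) F j x) = (fun=> 0).
    by apply/funext => x; rewrite big_nil.
  have -> : (fun i x => \sum_(j <- [::]) DF j i x) = (fun _ _ => 0).
    by apply/funext => i; apply/funext => x; rewrite big_nil.
  exact: by_parts_cst.
have -> : (fun x => \sum_(j <- j :: s) F j x) = (fun x => F j x + \sum_(j <- s) F j x).
  by apply/funext => x; rewrite big_cons.
have -> : (fun i x => \sum_(j <- j :: s) DF j i x) =
    (fun i x => DF j i x + \sum_(j <- s) DF j i x).
  by apply/funext => i; apply/funext => x; rewrite big_cons.
exact: by_partsD.
Qed.

(** The product rule. [Z j] is absorbed into the test monomial, whose exponent at j becomes e_j + 1;
    for i = j the extra 1 accounts for the derivative of [Z j] itself. *)
Lemma by_parts_mul_var j F DF : by_parts F DF ->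
  by_parts (fun x => Z j x * F x) (fun i x => (i == j)%:R * F x + Z j x * DF i x).
Proof.
move=> HF e; have [iF iDF eF] := HF e; have [iF' iDF' eF'] := HF (incr e j).
have iZ i : P.-integrable setT (fun x => (monomial e x * (Z j x * DF i x))%:E).
  by have := iDF' i; under eq_fun do rewrite monomial_incr (mulrC (Z j _)) -mulrA.
have iD i : P.-integrable setT (fun x => (monomial e x * ((i == j)%:R * F x))%:E).
  by under eq_fun do rewrite mulrCA; exact: integrableZR.
split => [|i|i].
- by move: iF'; under eq_fun do rewrite monomial_incr (mulrC (Z j _)) -mulrA.
- by under eq_fun do rewrite mulrDr; exact: integrableDR.
have -> : \int[P]_x (Z i x * (monomial e x * (Z j x * F x))) =
    \int[P]_x (Z i x * (monomial (incr e j) x * F x)).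
  by apply: eq_Rintegral => x _; rewrite monomial_incr; ring.
rewrite eF'; congr (_ * _).
have -> : \int[P]_x (monomial e x * ((i == j)%:R * F x + Z j x * DF i x)) =
    (i == j)%:R * \int[P]_x (monomial e x * F x) +
    \int[P]_x (monomial (incr e j) x * DF i x).
  rewrite -RintegralZl// -RintegralD//; [|exact: integrableZR|exact: iDF'].
  by apply: eq_Rintegral => x _; rewrite monomial_incr; ring.
rewrite addrA; congr (_ + _).
have [->|ij] := eqVneq i j.
  rewrite incrK /incr eqxx natrD mulrDl; congr (_ + _).
  have [->|ej] := posnP (e j); first by rewrite !mul0r.
  congr (_ * _); apply: eq_Rintegral => x _.
  by rewrite mulrCA mulrA -monomial_incr decrK.
rewrite incr_decr// /incr (negbTE ij) addn0 mul0r addr0; congr (_ * _).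
by apply: eq_Rintegral => x _; rewrite -/(incr _ _) monomial_incr; ring.
Qed.

Lemma by_parts_integrable F DF : by_parts F DF ->
  P.-integrable setT (fun x => (F x)%:E).
Proof.
move=> /(_ (fun=> 0%N))[+ _ _].
by under eq_fun do rewrite /monomial big1// mul1r.
Qed.

Lemma by_parts_integrable_diff F DF i : by_parts F DF ->
  P.-integrable setT (fun x => (DF i x)%:E).
Proof.
move=> /(_ (fun=> 0%N))[_ /(_ i) + _].
by under eq_fun do rewrite /monomial big1// mul1r.
Qed.

Lemma by_parts_expectation F DF i : by_parts F DF ->
  \int[P]_x (Z i x * F x) = sigma ^+ 2 * \int[P]_x DF i x.
Proof.
move=> /(_ (fun=> 0%N))[_ _ /(_ i)]; rewrite mul0r add0r.
under eq_Rintegral do rewrite /monomial big1// mul1r.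
by move=> ->; under eq_Rintegral do rewrite /monomial big1// mul1r.
Qed.

End gaussian_family.

(** * Frobenius inner product *)

Section frobenius.
Context {R : realType}.

Definition mxdot m p (A B : 'M[R]_(m, p)) : R := \tr (A^T *m B).
Definition sqnorm m p (A : 'M[R]_(m, p)) : R := mxdot A A.

Lemma mxdotE m p (A B : 'M[R]_(m, p)) : mxdot A B = \sum_i \sum_j A i j * B i j.
Proof.
rewrite /mxdot /mxtrace exchange_big /=; apply: eq_bigr => j _.
by rewrite mxE; apply: eq_bigr => i _; rewrite mxE.
Qed.

Lemma mxdotC m p (A B : 'M[R]_(m, p)) : mxdot A B = mxdot B A.
Proof. by rewrite /mxdot -mxtrace_tr trmx_mul trmxK. Qed.

Lemma mxdotDr m p (A B C : 'M[R]_(m, p)) : mxdot A (B + C) = mxdot A B + mxdot A C.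
Proof. by rewrite /mxdot mulmxDr mxtraceD. Qed.

Lemma mxdotZr m p (a : R) (A B : 'M[R]_(m, p)) : mxdot A (a *: B) = a * mxdot A B.
Proof. by rewrite /mxdot -scalemxAr mxtraceZ. Qed.

Lemma mxdotDl m p (A B C : 'M[R]_(m, p)) : mxdot (A + B) C = mxdot A C + mxdot B C.
Proof. by rewrite mxdotC mxdotDr !(mxdotC C). Qed.

Lemma mxdotZl m p (a : R) (A B : 'M[R]_(m, p)) : mxdot (a *: A) B = a * mxdot A B.
Proof. by rewrite mxdotC mxdotZr mxdotC. Qed.

Lemma mxdot_mull m p q (A : 'M[R]_(m, p)) (B : 'M[R]_(p, q)) (C : 'M[R]_(m, q)) :
  mxdot (A *m B) C = mxdot B (A^T *m C).
Proof. by rewrite /mxdot trmx_mul mulmxA. Qed.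

Lemma sqnormE m p (A : 'M[R]_(m, p)) : sqnorm A = \sum_i \sum_j A i j ^+ 2.
Proof. by rewrite /sqnorm mxdotE; under eq_bigr do under eq_bigr do rewrite -expr2. Qed.

Lemma sqnorm_col m (x : 'cV[R]_m) : sqnorm x = \sum_i x i 0 ^+ 2.
Proof. by rewrite sqnormE; under eq_bigr do rewrite big_ord1. Qed.

Lemma sqnorm_cols m p (A : 'M[R]_(m, p)) : sqnorm A = \sum_j sqnorm (col j A).
Proof.
rewrite sqnormE exchange_big /=; apply: eq_bigr => j _.
by rewrite sqnorm_col; under [RHS]eq_bigr do rewrite mxE.
Qed.

Lemma sqnorm_ge0 m p (A : 'M[R]_(m, p)) : 0 <= sqnorm A.
Proof. by rewrite sqnormE sumr_ge0// => i _; rewrite sumr_ge0// => j _; rewrite sqr_ge0. Qed.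

Lemma sqnorm_eq0 m p (A : 'M[R]_(m, p)) : sqnorm A = 0 -> A = 0.
Proof.
rewrite sqnormE => A0; apply/matrixP => i j; rewrite mxE.
have h k : 0 <= \sum_j A k j ^+ 2 by rewrite sumr_ge0// => l _; rewrite sqr_ge0.
have /eqP := psumr_eq0P (fun k _ => h k) A0 isT (i := i).
rewrite psumr_eq0 => [/allP/(_ j)|l _]; last exact: sqr_ge0.
by rewrite mem_index_enum sqrf_eq0 => /(_ isT)/eqP.
Qed.

Lemma sqnorm_tr m p (A : 'M[R]_(m, p)) : sqnorm A^T = sqnorm A.
Proof. by rewrite /sqnorm /mxdot trmxK mxtrace_mulC. Qed.

Lemma sqnorm0 m p : sqnorm (0 : 'M[R]_(m, p)) = 0.
Proof. by rewrite /sqnorm /mxdot mulmx0 mxtrace0. Qed.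

Lemma sqnormZ m p (a : R) (A : 'M[R]_(m, p)) : sqnorm (a *: A) = a ^+ 2 * sqnorm A.
Proof. by rewrite /sqnorm mxdotZl mxdotZr mulrA. Qed.

Lemma sqnormD m p (A B : 'M[R]_(m, p)) :
  sqnorm (A + B) = sqnorm A + 2 * mxdot A B + sqnorm B.
Proof. by rewrite /sqnorm mxdotDl !mxdotDr (mxdotC B A); ring. Qed.

Lemma mxdot_CauchySchwarz m p (A B : 'M[R]_(m, p)) :
  mxdot A B ^+ 2 <= sqnorm A * sqnorm B.
Proof.
have [B0|B0] := eqVneq (sqnorm B) 0.
  by rewrite (sqnorm_eq0 B0) -(scale0r B) mxdotZr mul0r expr0n sqnormZ expr0n /= mul0r mulr0.
have Bp : 0 < sqnorm B by rewrite lt_def B0 sqnorm_ge0.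
have := sqnorm_ge0 (sqnorm B *: A + (- mxdot A B) *: B).
rewrite sqnormD !sqnormZ mxdotZl mxdotZr.
have -> : sqnorm B ^+ 2 * sqnorm A + 2 * (sqnorm B * (- mxdot A B * mxdot A B)) +
  (- mxdot A B) ^+ 2 * sqnorm B = sqnorm B * (sqnorm A * sqnorm B - mxdot A B ^+ 2) by ring.
by rewrite pmulr_rge0// subr_ge0.
Qed.

Lemma mxdot_le m p (A B : 'M[R]_(m, p)) : 2 * mxdot A B <= sqnorm A + sqnorm B.
Proof.
have := sqnorm_ge0 (A + (-1) *: B).
by rewrite sqnormD sqnormZ mxdotZr; lra.
Qed.

Lemma sqnorm_col_mx m p q (B1 : 'M[R]_(m, q)) (B2 : 'M[R]_(p, q)) :
  sqnorm (col_mx B1 B2) = sqnorm B1 + sqnorm B2.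
Proof. by rewrite /sqnorm /mxdot tr_col_mx mul_row_col mxtraceD. Qed.

Lemma sqnorm_delta_mul k l q (i : 'I_k) (j : 'I_l) (B : 'M[R]_(l, q)) :
  sqnorm (delta_mx i j *m B) = sqnorm (row j B).
Proof.
have E k' t : (delta_mx i j *m B) k' t = (k' == i)%:R * B j t.
  rewrite mxE (bigD1 j)//= mxE eqxx andbT big1 ?addr0// => u uj.
  by rewrite mxE (negbTE uj) andbF mul0r.
rewrite !sqnormE big_ord1 (bigD1 i)//= [X in _ + X]big1 ?addr0.
  by apply: eq_bigr => t _; rewrite E eqxx mul1r mxE.
by move=> k' ki; rewrite big1// => t _; rewrite E (negbTE ki) mul0r expr0n.
Qed.

Lemma sqnorm_rows k q (B : 'M[R]_(k, q)) : sqnorm B = \sum_i sqnorm (row i B).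
Proof.
rewrite sqnormE; apply: eq_bigr => i _.
by rewrite sqnormE big_ord1; under [RHS]eq_bigr do rewrite mxE.
Qed.

Lemma sqnorm_mulmx_le k l (M : 'M[R]_(k, l)) (u : 'cV[R]_l) :
  sqnorm (M *m u) <= sqnorm M * sqnorm u.
Proof.
rewrite sqnorm_rows (sqnorm_rows M) mulr_suml; apply: ler_sum => i _.
rewrite row_mul.
have -> : sqnorm (row i M *m u) = mxdot (row i M)^T u ^+ 2.
  by rewrite sqnormE !big_ord1 /mxdot trmxK /mxtrace big_ord1.
by rewrite -(sqnorm_tr (row i M)) mxdot_CauchySchwarz.
Qed.

(** A maximum principle: at an interior maximiser, convexity forces the left neighbour to be a
    maximiser too, so the maximum is also reached at an end point. *)
Lemma discrete_convex_le (psi : nat -> R) (h : nat) (K : R) :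
  psi 0%N <= K -> psi h <= K ->
  (forall a, (0 < a < h)%N -> 2 * psi a <= psi a.-1 + psi a.+1) ->
  forall a, (a <= h)%N -> psi a <= K.
Proof.
move=> p0 ph conv.
have top i : (i <= h)%N -> (forall j, (j <= h)%N -> psi j <= psi i) -> psi i <= K.
  elim: i => [//|i IH] ih top.
  have [ihE|ihN] := eqVneq i.+1 h; first by rewrite ihE.
  have ih' : (i.+1 < h)%N by rewrite ltn_neqAle ihN.
  have /= c := conv i.+1 ih'.
  have t2 := top _ ih'.
  have e : psi i.+1 <= psi i by lra.
  apply: le_trans e _; apply: IH => [|j jh]; first exact: ltnW.
  have := top _ jh; lra.
move=> a ah.
have [i _ imax] := @Order.TotalTheory.arg_maxP _ _ _ (ord0 : 'I_h.+1) xpredT (fun i => psi i) isT.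
have := imax (Ordinal (ah : a < h.+1)%N) isT => /= /le_trans; apply.
apply: top => [|j jh]; first by rewrite -ltnS.
exact: (imax (Ordinal (jh : j < h.+1)%N) isT).
Qed.

Lemma trmx_sym_exp N (X : 'M[R]_N) k : X^T = X -> (X ^+ k)^T = X ^+ k.
Proof.
move=> sX; elim: k => [|k IH]; first exact: trmx1.
by rewrite [in LHS]exprS -mulmxE trmx_mul IH sX [RHS]exprSr.
Qed.

Lemma mulmx_exp N (X : 'M[R]_N) i j : X ^+ i *m X ^+ j = X ^+ (i + j).
Proof. by rewrite exprD. Qed.

(* With B_a = X^a A X^(h-a), the trace of A X^q A X^(2h-q) is <B_a, B_c> for
   a + c = 2h - q; Cauchy-Schwarz makes it midpoint convex in q. *)
Lemma mxtrace_interleave_le N (A X : 'M[R]_N) (h q : nat) : A^T = A -> X^T = X ->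
  (q <= h.*2)%N ->
  \tr (A *m X ^+ q *m A *m X ^+ (h.*2 - q)) <= \tr (A *m A *m X ^+ h.*2).
Proof.
move=> sA sX qh.
pose B a := X ^+ a *m A *m X ^+ (h - a).
have BB a c : (a <= h)%N -> (c <= h)%N ->
    mxdot (B a) (B c) = \tr (A *m X ^+ (a + c) *m A *m X ^+ (h.*2 - (a + c))).
  move=> ah ch; rewrite /mxdot /B !trmx_mul !trmx_sym_exp// sA.
  have -> : (h.*2 - (a + c) = (h - c) + (h - a))%N by lia.
  rewrite [LHS](_ : _ = \tr (X ^+ (h - a) *m (A *m (X ^+ a *m X ^+ c) *m A *m X ^+ (h - c)))); first
    by rewrite mxtrace_mulC mulmx_exp -(mulmxA (A *m X ^+ (a + c) *m A)) mulmx_exp.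
  by rewrite !mulmxA.
have top a : (a <= h)%N -> sqnorm (B a) <= \tr (A *m A *m X ^+ h.*2).
  move: a; apply: discrete_convex_le.
  - by rewrite /sqnorm BB// addn0 subn0 expr0 mulmx1.
  - by rewrite /sqnorm BB// addnn subnn expr0 mulmx1 mxtrace_mulC mulmxA.
  - move=> a /andP[a0 ah].
    have E : sqnorm (B a) = mxdot (B a.-1) (B a.+1).
      rewrite /sqnorm !BB//; try lia.
      by have -> : (a + a = a.-1 + a.+1)%N by lia.
    by rewrite E; exact: mxdot_le.
have -> : \tr (A *m X ^+ q *m A *m X ^+ (h.*2 - q)) = mxdot (B q./2) (B (uphalf q)).
  rewrite BB; try lia.
  by have -> : (q./2 + uphalf q = q)%N by lia.
have t1 : sqnorm (B q./2) <= _ := top _ _.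
have := mxdot_le (B q./2) (B (uphalf q)).
have := top q./2; have := top (uphalf q).
have -> : (q./2 <= h)%N by lia.
have -> : (uphalf q <= h)%N by lia.
move=> /(_ isT) x /(_ isT); lra.
Qed.

(** Put b_k = |X^k u|^2. Cauchy-Schwarz gives b_(k+1)^2 <= b_k b_(k+2), so the ratios of consecutive
    terms never decrease and stay above b_1 / b_0 = b_1. This stands in for Jensen's inequality
    under the spectral measure of u. *)
Lemma sqnorm_sym_exp_ge N (X : 'M[R]_N) (u : 'cV[R]_N) (k : nat) : X^T = X ->
  sqnorm u = 1 -> sqnorm (X *m u) ^+ k <= sqnorm (X ^+ k *m u).
Proof.
move=> sX u1; pose b k := sqnorm (X ^+ k *m u).
have b0 j : 0 <= b j by exact: sqnorm_ge0.
have b1 : b 1%N = sqnorm (X *m u) by rewrite /b expr1.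
have bk j : b j.+1 ^+ 2 <= b j * b j.+2.
  have -> : b j.+1 = mxdot (X ^+ j *m u) (X ^+ j.+2 *m u).
    rewrite /b /sqnorm exprS -mulmxE -mulmxA mxdot_mull sX.
    by rewrite [X ^+ j.+2]exprS [X ^+ j.+1]exprS -!mulmxE !mulmxA.
  exact: mxdot_CauchySchwarz.
have step j : b j * b 1%N <= b j.+1.
  elim: j => [|j IH]; first by rewrite {1}/b expr0 mul1mx u1 mul1r.
  have [e|ne] := eqVneq (b j.+1) 0; first by rewrite e mul0r.
  have p : 0 < b j.+1 by rewrite lt_def ne b0.
  rewrite -(ler_pM2l p) mulrA -expr2.
  apply: (@le_trans _ _ (b j * b j.+2 * b 1%N)); first by rewrite ler_wpM2r.
  by rewrite mulrAC ler_wpM2r.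
rewrite -b1; elim: k => [|k IH]; first by rewrite expr0 expr0 mul1mx u1.
by rewrite exprSr (le_trans _ (step k))// ler_wpM2r.
Qed.

End frobenius.

(** * Trace moments of Gaussian matrix series *)

Section gaussian_matrix_series.
Context {R : realType} {disp : measure_display} {S : measurableType disp}.
Context (P : probability S R) (I : finType) (Z : I -> {RV P >-> R}).
Context (sigma : R).
Hypothesis sigma_gt0 : 0 < sigma.
Hypothesis Z_indep : mutually_independent Z.
Hypothesis Z_normal : forall i, normally_distributed 0 sigma (Z i).
Context (N : nat) (A : I -> 'M[R]_N).
Hypothesis A_sym : forall i, (A i)^T = A i.

Definition gseries (x : S) : 'M[R]_N := \sum_i Z i x *: A i.
Local Notation X := gseries.

Lemma gseries_sym x : (X x)^T = X x.
Proof.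
by rewrite /X linear_sum; apply: eq_bigr => i _; rewrite linearZ /= A_sym.
Qed.

(** The derivative of X^k in the variable [Z i], by the noncommutative product rule. For k = 0 the
    sum is empty, so the truncated [k.-1] does no harm. *)
Definition gseries_diff k i x : 'M[R]_N :=
  \sum_(q < k) X x ^+ q *m A i *m X x ^+ (k.-1 - q).

Lemma gseries_diffS k i x :
  gseries_diff k.+1 i x = A i *m X x ^+ k + X x *m gseries_diff k i x.
Proof.
rewrite /gseries_diff big_ord_recl /= expr0 mul1mx subn0; congr (_ + _).
rewrite mulmx_sumr; apply: eq_bigr => q _; rewrite /bump /= add1n exprS.
rewrite -mulmxE !mulmxA; congr (_ *m X x ^+ _).
by have := ltn_ord q; lia.
Qed.

Lemma by_parts_gseriesX k a b :
  by_parts Z sigma (fun x => (X x ^+ k) a b) (fun i x => gseries_diff k i x a b).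
Proof.
elim: k a b => [|k IH] a b.
  have -> : (fun i x => gseries_diff 0 i x a b) = (fun _ _ => 0).
    apply/funext => i; apply/funext => x; rewrite /gseries_diff big_ord0 mxE//.
  have -> : (fun x => (X x ^+ 0) a b) = (fun=> (1%:M : 'M[R]_N) a b).
    by apply/funext => x; rewrite expr0.
  exact: (by_parts_cst sigma_gt0 Z_indep Z_normal).
have -> : (fun x => (X x ^+ k.+1) a b) =
    (fun x => \sum_c \sum_j A j a c * (Z j x * (X x ^+ k) c b)).
  apply/funext => x; rewrite exprS -mulmxE mxE; apply: eq_bigr => c _.
  rewrite /X summxE mulr_suml; apply: eq_bigr => j _.
  by rewrite mxE mulrAC mulrC.
have -> : (fun i x => gseries_diff k.+1 i x a b) =
    (fun i x => \sum_c \sum_j A j a c *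
       ((i == j)%:R * (X x ^+ k) c b + Z j x * gseries_diff k i x c b)).
  apply/funext => i; apply/funext => x; rewrite gseries_diffS !mxE -big_split /=.
  apply: eq_bigr => c _; under eq_bigr do rewrite mulrDr.
  rewrite big_split /=; congr (_ + _).
    rewrite (bigD1 i)//= eqxx mul1r big1 ?addr0// => j /negbTE ji.
    by rewrite eq_sym ji mul0r mulr0.
  rewrite summxE mulr_suml; apply: eq_bigr => j _.
  by rewrite mxE mulrCA mulrA.
apply: (by_parts_sum sigma_gt0 Z_indep Z_normal) => c; apply: (by_parts_sum sigma_gt0 Z_indep Z_normal) => j; apply: by_partsZ.
by apply: by_parts_mul_var; apply: IH.
Qed.

Lemma by_parts_gseries_trace (B : 'M[R]_N) k :
  by_parts Z sigma (fun x => \tr (B *m X x ^+ k))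
                   (fun i x => \tr (B *m gseries_diff k i x)).
Proof.
have -> : (fun x => \tr (B *m X x ^+ k)) =
    (fun x => \sum_a \sum_b B a b * (X x ^+ k) b a).
  by apply/funext => x; apply: eq_bigr => a _; rewrite mxE.
have -> : (fun i x => \tr (B *m gseries_diff k i x)) =
    (fun i x => \sum_a \sum_b B a b * gseries_diff k i x b a).
  by apply/funext => i; apply/funext => x; apply: eq_bigr => a _; rewrite mxE.
apply: (by_parts_sum sigma_gt0 Z_indep Z_normal) => a; apply: (by_parts_sum sigma_gt0 Z_indep Z_normal) => b; apply: by_partsZ.
exact: by_parts_gseriesX.
Qed.

Definition trace_moment p : R := \int[P]_x \tr (X x ^+ p.*2).

Lemma integrable_gseries_trace (B : 'M[R]_N) k :
  P.-integrable setT (fun x => (\tr (B *m X x ^+ k))%:E).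
Proof. exact: by_parts_integrable (by_parts_gseries_trace B k). Qed.

Lemma integrable_gseries_trace1 k :
  P.-integrable setT (fun x => (\tr (X x ^+ k))%:E).
Proof. by have := integrable_gseries_trace 1%:M k; under eq_fun do rewrite mul1mx. Qed.

Context (v : R).
Hypothesis v_bound : forall B : 'M[R]_N,
  \tr (B^T *m (\sum_i A i *m A i) *m B) <= v * \tr (B^T *m B).

(** One factor X is expanded as the sum of the [Z i *: A i] and each [Z i] is integrated by parts.
    Each of the 2p + 1 terms of the derivative is at most tr(A_i^2 X^(2p)) by
    [mxtrace_interleave_le], and [v_bound] at B = X^p bounds their sum over i. *)
Lemma trace_moment_rec p :
  trace_moment p.+1 <= sigma ^+ 2 * (p.*2.+1)%:R * v * trace_moment p.
Proof.
have iR (J : Type) (s : seq J) (F : J -> S -> R) :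
    (forall j, P.-integrable setT (fun x => (F j x)%:E)) ->
    P.-integrable setT (fun x => (\sum_(j <- s) F j x)%:E) /\
    \int[P]_x (\sum_(j <- s) F j x) = \sum_(j <- s) \int[P]_x F j x.
  move=> iF; elim: s => [|j s [IH1 IH2]].
    under eq_fun do rewrite big_nil; rewrite big_nil.
    under eq_Rintegral do rewrite big_nil; rewrite Rintegral_cst// mul0r.
    by split => //; exact: integrable0.
  under eq_fun do rewrite big_cons; rewrite big_cons.
  under eq_Rintegral do rewrite big_cons; rewrite RintegralD//; last exact: iF.
  rewrite IH2.
  by split => //; have := integrableD measurableT (iF j) IH1; exact.
have -> : trace_moment p.+1 =
    sigma ^+ 2 * \int[P]_x (\sum_i \tr (A i *m gseries_diff p.*2.+1 i x)).
  have E x : \tr (X x ^+ p.+1.*2) = \sum_i Z i x * \tr (A i *m X x ^+ p.*2.+1).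
    rewrite doubleS exprS -mulmxE {1}/X mulmx_suml linear_sum /=.
    by apply: eq_bigr => i _; rewrite -scalemxAl linearZ.
  rewrite /trace_moment; under eq_Rintegral do rewrite E.
  have [_ ->] := iR _ (index_enum I) _ (fun i => by_parts_integrable
    (by_parts_mul_var i (by_parts_gseries_trace (A i) p.*2.+1))).
  have [_ ->] := iR _ (index_enum I) _ (fun i => by_parts_integrable_diff i
    (by_parts_gseries_trace (A i) p.*2.+1)).
  rewrite mulr_sumr; apply: eq_bigr => i _.
  exact: by_parts_expectation (by_parts_gseries_trace (A i) p.*2.+1).
rewrite -[leRHS]mulrA -[leRHS]mulrA; apply: (ler_wpM2l (sqr_ge0 _)).
rewrite /trace_moment -RintegralZl//; last exact: integrable_gseries_trace1.
rewrite -RintegralZl//; last first.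
  have := integrableZl measurableT v (integrable_gseries_trace1 p.*2).
  by under eq_fun do rewrite -EFinM.
apply: le_Rintegral => //.
- have [+ _] := iR _ (index_enum I) _ (fun i => by_parts_integrable_diff i
    (by_parts_gseries_trace (A i) p.*2.+1)).
  exact.
- have := integrableZl measurableT ((p.*2.+1)%:R * v) (integrable_gseries_trace1 p.*2).
  by under eq_fun do rewrite -EFinM -mulrA.
move=> x _.
apply: (@le_trans _ _ (\sum_i \sum_(q < p.*2.+1) \tr (A i *m A i *m X x ^+ p.*2))).
  apply: ler_sum => i _; rewrite /gseries_diff mulmx_sumr linear_sum /=.
  apply: ler_sum => q _; rewrite !mulmxA.
  apply: mxtrace_interleave_le; rewrite ?gseries_sym ?A_sym//.
  by have := ltn_ord q; lia.
under eq_bigr do rewrite sumr_const card_ord.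
rewrite sumrMnl -[leLHS]mulr_natl ler_wpM2l//.
have -> : \sum_i \tr (A i *m A i *m X x ^+ p.*2) =
    \tr ((X x ^+ p)^T *m (\sum_i A i *m A i) *m X x ^+ p).
  rewrite trmx_sym_exp ?gseries_sym// -mulmxA mxtrace_mulC -mulmxA mulmx_exp addnn.
  by rewrite mulmx_suml linear_sum.
apply: le_trans (v_bound _) _.
by rewrite trmx_sym_exp ?gseries_sym// mulmx_exp addnn.
Qed.

(** Iterating the recursion produces (2p - 1)!!, and (2p - 1)!! / (2p)! = 1 / (2^p p!). The
    right-hand sides are therefore terms of an exponential series. *)
Lemma trace_moment_le p : 0 <= v ->
  trace_moment p / (p.*2)`!%:R <= (sigma ^+ 2 * v / 2) ^+ p / p`!%:R * N%:R.
Proof.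
move=> v0; elim: p => [|p IH].
  rewrite /trace_moment /= expr0 fact0 !divr1.
  under eq_Rintegral do rewrite expr0 mxtrace1.
  rewrite Rintegral_cst//.
  by have /= -> := @probability_setT _ _ _ P; rewrite mulr1 mul1r.
rewrite ler_pdivrMr ?ltr0n ?fact_gt0//.
apply: le_trans (trace_moment_rec p) _.
rewrite -ler_pdivrMr ?ltr0n ?fact_gt0//.
have -> : sigma ^+ 2 * (p.*2.+1)%:R * v * trace_moment p / (p.+1.*2)`!%:R =
    (sigma ^+ 2 * v / 2) / (p.+1)%:R * (trace_moment p / (p.*2)`!%:R).
  rewrite doubleS !factS !natrM.
  have -> : (p.*2.+2)%:R = 2 * p.+1%:R :> R by rewrite -natrM mul2n.
  field.
  by rewrite !nat1r !pnatr_eq0 -!lt0n !fact_gt0.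
have -> : (sigma ^+ 2 * v / 2) ^+ p.+1 / (p.+1)`!%:R * N%:R =
    (sigma ^+ 2 * v / 2) / (p.+1)%:R * ((sigma ^+ 2 * v / 2) ^+ p / p`!%:R * N%:R).
  rewrite exprS factS natrM; field.
  by rewrite ?nat1r !pnatr_eq0 -!lt0n !fact_gt0.
by apply: ler_wpM2l => //; rewrite divr_ge0// divr_ge0// mulr_ge0// sqr_ge0.
Qed.

End gaussian_matrix_series.

(** * Tail bound for rectangular Gaussian matrices *)

Section exponential_sums.
Context {R : realType}.

Lemma exp_partial_sum_le (y : R) n : 0 <= y ->
  \sum_(k < n) y ^+ k / k`!%:R <= expR y.
Proof.
move=> y0; rewrite -(big_mkord xpredT (fun k => y ^+ k / k`!%:R)).
apply: (@nondecreasing_cvgn_le _ (series (exp_coeff y))); last exact: is_cvg_series_exp_coeff.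
apply/nondecreasing_seqP => k; rewrite /series /= big_nat_recr//= lerDl.
by rewrite /exp_coeff /= divr_ge0// exprn_ge0.
Qed.

(** The limit exp(a) + exp(-a) exceeds exp(a) by exp(-a), which is the tolerance granted to the
    partial sums. *)
Lemma cosh_partial_sum_ge (a : R) : exists n,
  expR a <= 2 * \sum_(k < n) a ^+ k.*2 / (k.*2)`!%:R.
Proof.
have cv x : series (exp_coeff x) @ \oo --> (expR x : R) by exact: is_cvg_series_exp_coeff.
have cD : (series (exp_coeff a) + series (exp_coeff (- a))) @ \oo -->
    (expR a + expR (- a) : R) by exact: cvgD.
move/cvgrPdist_lt : cD => cosh_cvg.
have [M _ HM] := cosh_cvg _ (expR_gt0 (- a)).
exists M.
have := HM M.*2; rewrite /= -addnn leq_addr => /(_ isT) /ltr_normlW.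
have -> : (series (exp_coeff a) + series (exp_coeff (- a))) (M + M)%N =
    2 * \sum_(k < M) a ^+ k.*2 / (k.*2)`!%:R.
  rewrite addnn; elim: M {HM} => [|M IH].
    by rewrite big_ord0 mulr0 /series /= fctE !big_geq// addr0.
  move: IH; rewrite !fctE doubleS big_ord_recr /= mulrDr => <-.
  rewrite /series /= !big_nat_recr//= /exp_coeff /=.
  have even : (- a) ^+ M.*2 = a ^+ M.*2 by rewrite -!mul2n !exprM sqrrN.
  have odd : (- a) ^+ M.*2.+1 = - a ^+ M.*2.+1 by rewrite exprS even exprS mulNr.
  by rewrite even odd mulNr; lra.
lra.
Qed.

End exponential_sums.

Section gaussian_rectangular_tail.
Context {R : realType} {disp : measure_display} {S : measurableType disp}.
Context (P : probability S R) (I : finType) (Z : I -> {RV P >-> R}).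
Context (sigma : R).
Hypothesis sigma_gt0 : 0 < sigma.
Hypothesis Z_indep : mutually_independent Z.
Hypothesis Z_normal : forall i, normally_distributed 0 sigma (Z i).
Context (m p : nat) (rowi : I -> 'I_m) (coli : I -> 'I_p) (b : I -> R) (v : R).
Hypothesis row_bound : forall s, \sum_(i | rowi i == s) b i ^+ 2 <= v.
Hypothesis col_bound : forall c, \sum_(i | coli i == c) b i ^+ 2 <= v.

Definition gmatrix (x : S) : 'M[R]_(m, p) :=
  \sum_i (Z i x * b i) *: delta_mx (rowi i) (coli i).

Definition dilation (G : 'M[R]_(m, p)) : 'M[R]_(m + p) := block_mx 0 G G^T 0.

Lemma dilation_sym G : (dilation G)^T = dilation G.
Proof. by rewrite /dilation tr_block_mx !trmx0 trmxK. Qed.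

Let A i : 'M[R]_(m + p) := b i *: dilation (delta_mx (rowi i) (coli i)).

Let A_sym i : (A i)^T = A i.
Proof. by rewrite /A linearZ /= dilation_sym. Qed.

Lemma gseries_dilation x : gseries Z A x = dilation (gmatrix x).
Proof.
rewrite /gseries /gmatrix /dilation.
rewrite (big_morph (fun G => block_mx 0 G G^T 0) (id1 := 0) (op1 := +%R)); last 2 first.
- by move=> G H; rewrite add_block_mx !addr0 linearD.
- by rewrite trmx0 block_mx0.
apply: eq_bigr => i _; rewrite /A /dilation scalerA.
by rewrite scale_block_mx !scaler0 linearZ.
Qed.

Lemma weighted_rows_le k q (idx : I -> 'I_k) (B : 'M[R]_(k, q)) :
  (forall s, \sum_(i | idx i == s) b i ^+ 2 <= v) ->
  \sum_i b i ^+ 2 * sqnorm (row (idx i) B) <= v * sqnorm B.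
Proof.
move=> hv; rewrite (partition_big idx xpredT)//= sqnorm_rows mulr_sumr.
apply: ler_sum => s _.
rewrite (eq_bigr (fun i => b i ^+ 2 * sqnorm (row s B))) => [|i /eqP -> //].
by rewrite -mulr_suml ler_wpM2r// sqnorm_ge0.
Qed.

(** The square of [A i] is diagonal, with b_i^2 at the positions of its row and of its column.
    Summed over i, the diagonal consists of the row sums and column sums of the b_i^2. *)
Lemma dilation_variance_le (B : 'M[R]_(m + p)) :
  \tr (B^T *m (\sum_i A i *m A i) *m B) <= v * \tr (B^T *m B).
Proof.
have -> : \tr (B^T *m (\sum_i A i *m A i) *m B) = \sum_i sqnorm (A i *m B).
  rewrite mulmx_sumr mulmx_suml linear_sum; apply: eq_bigr => i _ /=.
  rewrite /sqnorm /mxdot trmx_mul.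
  by rewrite A_sym !mulmxA.
rewrite -[\tr (_ *m B)]/(sqnorm B) -(vsubmxK B) sqnorm_col_mx mulrDr.
set B1 := usubmx B; set B2 := dsubmx B.
have -> : \sum_i sqnorm (A i *m col_mx B1 B2) =
   \sum_i b i ^+ 2 * sqnorm (row (rowi i) B1) +
   \sum_i b i ^+ 2 * sqnorm (row (coli i) B2).
  rewrite -big_split; apply: eq_bigr => i _ /=.
  rewrite /A -scalemxAl sqnormZ /dilation mul_block_col !mul0mx add0r addr0.
  by rewrite sqnorm_col_mx trmx_delta !sqnorm_delta_mul -mulrDr addrC.
by rewrite lerD// weighted_rows_le.
Qed.

(** tr H^(2k) is the squared Frobenius norm of H^k, whose columns split into the first m and the
    last p. Testing H^k on (y, 0), with y the direction of G u, and on (0, u) shows that each group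
    of columns contributes at least |G u|^(2k). These two contributions play the role of an
    eigenvalue pair. *)
Lemma dilation_exp_ge (G : 'M[R]_(m, p)) (u : 'cV[R]_p) k : (0 < m)%N ->
  sqnorm u = 1 -> 2 * sqnorm (G *m u) ^+ k <= \tr (dilation G ^+ k.*2).
Proof.
move=> m_gt0 u1; set X := dilation G; set s := sqnorm (G *m u).
have sX : X^T = X by exact: dilation_sym.
have trE : \tr (X ^+ k.*2) = sqnorm (X ^+ k).
  by rewrite /sqnorm /mxdot trmx_sym_exp// mulmx_exp addnn.
have p_gt0 : (0 < p)%N.
  rewrite lt0n; apply/eqP => p0; move: u1; rewrite sqnormE big1 => [/esym/eqP|i].
    by rewrite oner_eq0.
  by have := ltn_ord i; rewrite {2}p0.
have [s0|s0] := eqVneq s 0.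
  (* For k = 0 the claim is 2 <= m + p. *)
  case: (k) trE => [|l] trE; last by rewrite trE s0 expr0n /= mulr0 sqnorm_ge0.
  by rewrite !expr0 mulr1 mxtrace1 ler_nat (leq_add m_gt0 p_gt0).
have sp : 0 < s by rewrite lt_def s0 sqnorm_ge0.
pose y := (Num.sqrt s)^-1 *: (G *m u).
have y1 : sqnorm y = 1 by rewrite /y sqnormZ exprVn sqr_sqrtr ?mulVf// ltW.
pose u1' : 'cV[R]_(m + p) := col_mx 0 u.
pose u2' : 'cV[R]_(m + p) := col_mx y 0.
have n1 : sqnorm u1' = 1 by rewrite sqnorm_col_mx sqnorm0 add0r.
have n2 : sqnorm u2' = 1 by rewrite sqnorm_col_mx sqnorm0 addr0.
have e1 : sqnorm (X *m u1') = s.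
  by rewrite /X /dilation mul_block_col !mul0mx mulmx0 add0r addr0 sqnorm_col_mx sqnorm0 addr0.
(* Cauchy-Schwarz against the unit vector u: the inner product of G^T y and u is that of y and G u,
   namely |G u|. *)
have e2 : s <= sqnorm (X *m u2').
  rewrite /X /dilation mul_block_col !mul0mx mulmx0 add0r addr0 sqnorm_col_mx sqnorm0 add0r.
  have := mxdot_CauchySchwarz (G^T *m y) u.
  rewrite u1 mulr1 mxdot_mull trmxK /y mxdotZl exprMn exprVn sqr_sqrtr; last exact: ltW.
  by rewrite -/(sqnorm _) -/s expr2 mulrA mulVf// mul1r.
have k1 := sqnorm_sym_exp_ge k sX n1.
have k2 := sqnorm_sym_exp_ge k sX n2.
rewrite trE mulr2n mulrDl mul1r.
have [L [Q XE]] : exists L, exists Q, X ^+ k = row_mx L Q.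
  by exists (lsubmx (X ^+ k)), (rsubmx (X ^+ k)); rewrite hsubmxK.
have LQ : sqnorm (X ^+ k) = sqnorm L + sqnorm Q.
  by rewrite XE -sqnorm_tr tr_row_mx sqnorm_col_mx !sqnorm_tr.
rewrite LQ addrC; apply: lerD.
  apply: (@le_trans _ _ (sqnorm (X *m u2') ^+ k)).
    by rewrite lerXn2r ?nnegrE ?sqnorm_ge0// ltW.
  apply: le_trans k2 _; rewrite XE mul_row_col mulmx0 addr0.
  by apply: le_trans (sqnorm_mulmx_le _ _) _; rewrite y1 mulr1.
rewrite -[X in X <= _](congr1 (fun z => z ^+ k) e1).
apply: le_trans k1 _; rewrite XE mul_row_col mulmx0 add0r.
by apply: le_trans (sqnorm_mulmx_le _ _) _; rewrite u1 mulr1.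
Qed.

Lemma gaussian_matrix_tail : (0 < m)%N -> (0 < p)%N -> 0 < v ->
  exists E : set S, [/\ measurable E, ((1 - (m + p)%:R^-1)%:E <= P E)%E &
    forall x, E x -> forall u : 'cV[R]_p,
      sqnorm (gmatrix x *m u) <= 4 * sigma ^+ 2 * v * ln (m + p)%:R * sqnorm u].
Proof.
move=> m_gt0 p_gt0 v_gt0; set D : R := (m + p)%:R; set L := ln D.
have D2 : 2 <= D by rewrite /D ler_nat (leq_add m_gt0 p_gt0).
have D0 : 0 < D by rewrite (lt_le_trans _ D2).
have L0 : 0 < L by rewrite ln_gt0// (lt_le_trans _ D2)// ltr1n.
have eL : expR L = D by rewrite lnK ?posrE.
have [n Hn] := cosh_partial_sum_ge (4 * L).
(* [w] is s^2 for s = t / (sigma^2 v), which minimises exp(sigma^2 v s^2 / 2 - s t); with t^2 = [T]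
   below, s t = 4 L. *)
pose w := 4 * L / (sigma ^+ 2 * v).
have s2v : 0 < sigma ^+ 2 * v by rewrite mulr_gt0// exprn_gt0.
have w0 : 0 < w by rewrite divr_gt0// mulr_gt0.
set T := 4 * sigma ^+ 2 * v * L.
have T0 : 0 < T by rewrite /T -mulrA mulr_gt0// mulr_gt0// mulr_gt0// exprn_gt0.
have wT : w * T = (4 * L) ^+ 2.
  by rewrite /w /T; field; rewrite !gt_eqF.
pose c k : R := w ^+ k / (k.*2)`!%:R.
have c0 k : 0 < c k by rewrite /c divr_gt0 ?exprn_gt0// ltr0n fact_gt0.
(* [F] and [Q] are tr cosh(s H) and cosh(s t), truncated after the same [n] terms. *)
pose F x := \sum_(k < n) c k * \tr (gseries Z A x ^+ k.*2).
pose Q := \sum_(k < n) c k * T ^+ k.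
have QD : D ^+ 4 <= 2 * Q.
  apply: le_trans (_ : expR (4 * L) <= _); first by rewrite expRM_natl eL.
  apply: le_trans Hn _; rewrite ler_pM2l//; apply: ler_sum => k _.
  by rewrite /c mulrAC -exprMn wT -exprM mul2n.
have F0 x : 0 <= F x.
  rewrite sumr_ge0// => k _; rewrite mulr_ge0 ?(ltW (c0 _))//.
  rewrite gseries_dilation -addnn exprD -[X in X * _]trmx_sym_exp ?dilation_sym//.
  exact: sqnorm_ge0.
have iF k : P.-integrable setT (fun x => (c k * \tr (gseries Z A x ^+ k.*2))%:E).
  have := integrable_gseries_trace1 sigma_gt0 Z_indep Z_normal A k.*2.
  move=> /(integrableZl measurableT (c k)).
  by under eq_fun do rewrite -EFinM.
have EF : P.-integrable setT (fun x => (F x)%:E) /\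
    \int[P]_x F x = \sum_(k < n) c k * trace_moment Z A k.
  rewrite /F; elim: (n) => [|l [IH1 IH2]].
    under eq_fun do rewrite big_ord0; rewrite big_ord0.
    under eq_Rintegral do rewrite big_ord0; rewrite Rintegral_cst// mul0r.
    by split => //; exact: integrable0.
  under eq_fun do rewrite big_ord_recr; rewrite big_ord_recr.
  under eq_Rintegral do rewrite big_ord_recr; rewrite RintegralD//=; last exact: iF.
  rewrite IH2 RintegralZl//; last first.
    exact: (integrable_gseries_trace1 sigma_gt0 Z_indep Z_normal A l.*2).
  by split => //; have := integrableD measurableT IH1 (iF l); exact.
have [iFF EFE] := EF.
(* The exponential series gives exp(sigma^2 v s^2 / 2) = exp(2 L) = D^2, and the size of H
   contributes another D. *)
have EFD : \int[P]_x F x <= D ^+ 3.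
  rewrite EFE.
  apply: (@le_trans _ _ (\sum_(k < n) (2 * L) ^+ k / k`!%:R * D)).
    apply: ler_sum => k _; rewrite /c mulrAC -mulrA.
    have := trace_moment_le sigma_gt0 Z_indep Z_normal A_sym dilation_variance_le k (ltW v_gt0).
    move/(ler_wpM2l (ltW (exprn_gt0 k w0))) => /le_trans; apply.
    rewrite !mulrA -exprMn; apply: ler_wpM2r; first exact: ltW.
    rewrite le_eqVlt; apply/orP; left; apply/eqP; congr (_ ^+ _ / _).
    by rewrite /w; field; rewrite !gt_eqF.
  rewrite -mulr_suml exprSr; apply: ler_wpM2r; first exact: ltW.
  apply: le_trans (exp_partial_sum_le _ _) _; first by rewrite mulr_ge0// ltW.
  by rewrite expRM_natl eL.
have mF : measurable_fun setT F by apply/measurable_EFinP; exact: measurable_int iFF.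
have Q0 : 0 < 2 * Q by apply: lt_le_trans QD; rewrite exprn_gt0.
have mE : measurable [set x | F x < 2 * Q].
  have -> : [set x | F x < 2 * Q] = F @^-1` [set` `]-oo, (2 * Q)[].
    by apply/seteqP; split => x /=; rewrite in_itv.
  by rewrite -[X in measurable X]setTI; apply: mF => //; exact: measurable_itv.
exists [set x | F x < 2 * Q]; split => //.
(* Markov's inequality: the complement has probability at most D^3 / D^4. *)
- have := @le_integral_comp_abse _ _ _ P _ measurableT (EFin \o F) (2 * Q) id.
  move=> /(_ (@measurable_id _ _ _)) /=.
  have -> : (\int[P]_x `|(F x)%:E| = (\int[P]_x F x)%:E)%E.
    rewrite /Rintegral fineK; last exact: integrable_fin_num.
    by apply: eq_integral => x _; rewrite gee0_abs// lee_fin.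
  have mEF : measurable_fun setT (EFin \o F) by exact/measurable_EFinP.
  move=> /(_ _ _ mEF Q0).
  have -> : setT `&` [set x | ((2 * Q)%:E <= `|(F x)%:E|)%E] = ~` [set x | F x < 2 * Q].
    apply/seteqP; split => x /=.
      by case=> _; rewrite lee_fin ger0_norm// => le; apply/negP; rewrite -leNgt.
    by move/negP; rewrite -leNgt lee_fin ger0_norm.
  rewrite probability_setC// => markovF.
  have /fineK PE := fin_num_measure P _ mE; rewrite -PE lee_fin.
  have : 2 * Q * (1 - fine (P [set x | F x < 2 * Q])) <= D ^+ 3.
    apply: le_trans EFD; rewrite -lee_fin EFinM EFinB PE; apply: markovF => //.
  set e := fine _ => He.
  have : D ^+ 4 * (1 - e) <= D ^+ 3.
    apply: le_trans He; apply: ler_wpM2r => //.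
    rewrite subr_ge0 -lee_fin /e PE; exact: probability_le1.
  rewrite exprSr -mulrA -[leRHS]mulr1 ler_pM2l ?exprn_gt0// => h.
  by rewrite lerBlDr -lerBlDl -(ler_pM2l D0) mulfV// gt_eqF.
- move=> x /= Fx u.
  have [u0|u0] := eqVneq (sqnorm u) 0.
    by rewrite (sqnorm_eq0 u0) mulmx0 !sqnorm0 mulr0.
  have up : 0 < sqnorm u by rewrite lt_def u0 sqnorm_ge0.
  pose u' := (Num.sqrt (sqnorm u))^-1 *: u.
  have u'1 : sqnorm u' = 1 by rewrite /u' sqnormZ exprVn sqr_sqrtr ?mulVf// ltW.
  have -> : sqnorm (gmatrix x *m u) = sqnorm (gmatrix x *m u') * sqnorm u.
    by rewrite /u' -scalemxAr sqnormZ exprVn sqr_sqrtr ?ltW// mulrAC mulVf// mul1r.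
  apply: ler_wpM2r; first exact: ltW.
  (* If |G u'|^2 exceeded [T], then [dilation_exp_ge] would give F x >= 2 Q term by term. *)
  rewrite leNgt; apply/negP => TG; move: Fx; apply/negP; rewrite -leNgt.
  rewrite /Q mulr_sumr; apply: ler_sum => k _.
  rewrite mulrCA; apply: ler_wpM2l; first exact: ltW.
  rewrite gseries_dilation.
  apply: le_trans (dilation_exp_ge (gmatrix x) k m_gt0 u'1).
  by rewrite ler_pM2l// lerXn2r ?nnegrE// ?sqnorm_ge0// ltW.
Qed.

End gaussian_rectangular_tail.

(** * Singular projections *)

Section operator_norm.
Context {R : realType}.

Definition fnorm m p (A : 'M[R]_(m, p)) : R := Num.sqrt (sqnorm A).

Lemma fnorm_ge0 m p (A : 'M[R]_(m, p)) : 0 <= fnorm A.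
Proof. exact: sqrtr_ge0. Qed.

Lemma fnorm_sqr m p (A : 'M[R]_(m, p)) : fnorm A ^+ 2 = sqnorm A.
Proof. by rewrite sqr_sqrtr// sqnorm_ge0. Qed.

Lemma fnormD m p (A B : 'M[R]_(m, p)) : fnorm (A + B) <= fnorm A + fnorm B.
Proof.
rewrite -(@ler_pXn2r _ 2)// ?nnegrE ?addr_ge0 ?fnorm_ge0//.
rewrite sqrrD !fnorm_sqr sqnormD lerD2r lerD2l.
have : mxdot A B <= fnorm A * fnorm B.
  rewrite (le_trans (ler_norm _))// -(@ler_pXn2r _ 2)// ?nnegrE ?mulr_ge0 ?fnorm_ge0//.
  by rewrite real_normK ?num_real// exprMn !fnorm_sqr mxdot_CauchySchwarz.
by move=> le; rewrite mulr_natl lerMn2r.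
Qed.

Lemma fnormZ m p a (A : 'M[R]_(m, p)) : fnorm (a *: A) = `|a| * fnorm A.
Proof. by rewrite /fnorm sqnormZ sqrtrM ?sqr_ge0// sqrtr_sqr. Qed.

Lemma fnormN m p (A : 'M[R]_(m, p)) : fnorm (- A) = fnorm A.
Proof. by rewrite -scaleN1r fnormZ normrN1 mul1r. Qed.

Lemma vnorm2E m (x : 'cV[R]_m) : vnorm2 x = fnorm x.
Proof. by rewrite /vnorm2 /fnorm sqnorm_col. Qed.

(** A relation rather than a supremum, so that sums, products and projections can be bounded vector
    by vector. *)
Definition opnorm_le m p (A : 'M[R]_(m, p)) (K : R) : Prop :=
  forall u : 'cV[R]_p, fnorm (A *m u) <= K * fnorm u.

Lemma fnorm_mulmx_le k l q (M : 'M[R]_(k, l)) (B : 'M[R]_(l, q)) K :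
  0 <= K -> opnorm_le M K -> fnorm (M *m B) <= K * fnorm B.
Proof.
move=> K0 MK; rewrite -(@ler_pXn2r _ 2)// ?nnegrE ?mulr_ge0 ?fnorm_ge0//.
rewrite exprMn !fnorm_sqr sqnorm_cols (sqnorm_cols B) mulr_sumr.
apply: ler_sum => j _; rewrite !colE -mulmxA -!fnorm_sqr -exprMn.
by rewrite lerXn2r ?nnegrE ?mulr_ge0 ?fnorm_ge0.
Qed.

(** The Frobenius norm bounds the set in [spectral_norm], so its supremum is a true one; homogeneity
    extends the bound beyond the unit ball. *)
Lemma opnorm_le_spectral m p (A : 'M[R]_(m, p)) :
  0 <= spectral_norm A /\ opnorm_le A (spectral_norm A).
Proof.
have ub : has_ubound [set vnorm2 (A *m x) | x in [set x : 'cV[R]_p | vnorm2 x <= 1]].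
  exists (fnorm A) => _ [x /= x1 <-]; rewrite !vnorm2E in x1 *.
  rewrite -[leRHS]mulr1 -(@ler_pXn2r _ 2)// ?nnegrE ?mulr_ge0 ?fnorm_ge0//.
  rewrite exprMn !fnorm_sqr (le_trans (sqnorm_mulmx_le _ _))// expr1n.
  by rewrite ler_wpM2l ?sqnorm_ge0// -fnorm_sqr exprn_ile1 ?fnorm_ge0.
have spec (u : 'cV[R]_p) : fnorm u <= 1 -> fnorm (A *m u) <= spectral_norm A.
  by move=> u1; apply: (ub_le_sup ub); exists u; rewrite /= ?vnorm2E.
have fn0 q : fnorm (0 : 'cV[R]_q) = 0 by rewrite /fnorm sqnorm0 sqrtr0.
split; first by have := spec 0; rewrite mulmx0 !fn0 ler01; apply.
move=> u; have [u0|u0] := eqVneq (fnorm u) 0.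
  have : sqnorm u = 0 by rewrite -fnorm_sqr u0 expr0n.
  by move/sqnorm_eq0 => ->; rewrite mulmx0 !fn0 mulr0.
have up : 0 < fnorm u by rewrite lt_def u0 fnorm_ge0.
have := spec ((fnorm u)^-1 *: u).
rewrite -scalemxAr !fnormZ ger0_norm ?invr_ge0 ?fnorm_ge0// mulVf// lexx => /(_ isT).
by rewrite ler_pdivrMl// mulrC.
Qed.

Lemma opnorm_leD m p (A B : 'M[R]_(m, p)) K L :
  opnorm_le A K -> opnorm_le B L -> opnorm_le (A + B) (K + L).
Proof.
move=> AK BL u; rewrite mulmxDl mulrDl (le_trans (fnormD _ _))// lerD//.
Qed.

Lemma row_free_mulmx_tr r p (D : 'M[R]_(r, p)) : row_free D -> D *m D^T \in unitmx.
Proof.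
move=> fD; rewrite -row_free_unit; apply: inj_row_free => v vDD.
have Dv : D *m D^T *m v^T = 0 by apply: trmx_inj; rewrite !trmx_mul !trmxK trmx0.
have : sqnorm (D^T *m v^T) = 0.
  by rewrite /sqnorm mxdot_mull trmxK mulmxA Dv /mxdot mulmx0 mxtrace0.
move/sqnorm_eq0 => /(congr1 trmx); rewrite trmx_mul !trmxK trmx0 => vD.
by apply: (row_free_inj fD); rewrite vD mul0mx.
Qed.

(* The orthogonal projection onto the row space of B has squared Frobenius
   norm rank B, and B is unchanged by it. *)
Lemma fnorm_le_rank m p (B : 'M[R]_(m, p)) K : 0 <= K -> opnorm_le B K ->
  fnorm B <= Num.sqrt (\rank B)%:R * K.
Proof.
move=> K0 BK.
have [C [D [fD BE]]] : exists C : 'M[R]_(m, \rank B), exists D : 'M[R]_(\rank B, p),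
    row_free D /\ B = C *m D.
  by exists (col_base B), (row_base B); rewrite mulmx_base row_base_free.
have uD : D *m D^T \in unitmx by exact: row_free_mulmx_tr fD.
pose pi := D^T *m invmx (D *m D^T) *m D.
have Dpi : D *m pi = D by rewrite /pi !mulmxA mulmxV// mul1mx.
have Bpi : B *m pi = B by rewrite [in LHS]BE -mulmxA Dpi.
have tpi : pi^T = pi.
  by rewrite /pi 2!trmx_mul trmx_inv trmx_mul !trmxK mulmxA.
have npi : fnorm pi = Num.sqrt (\rank B)%:R.
  rewrite /fnorm /sqnorm /mxdot tpi; congr Num.sqrt.
  rewrite {1}/pi -mulmxA Dpi mxtrace_mulC mulmxA mulmxV//.
  by rewrite mxtrace1.
by rewrite -{1}Bpi -npi mulrC; exact: fnorm_mulmx_le.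
Qed.

(** * Singular values and projections on leading singular vectors *)

Definition sdiag m p (s : nat -> R) : 'M[R]_(m, p) :=
  \matrix_(i < m, j < p) (s i *+ (i == j :> nat)).

Lemma sqnorm_sdiag_mul m p s (z : 'cV[R]_p) :
  sqnorm (sdiag m p s *m z) = \sum_(j < p) (if (j < m)%N then s j ^+ 2 * z j 0 ^+ 2 else 0).
Proof.
rewrite sqnorm_col.
have E (i : 'I_m) : ((sdiag m p s *m z) i 0) ^+ 2 =
    \sum_(j < p) (if (i == j :> nat) then s i ^+ 2 * z j 0 ^+ 2 else 0).
  rewrite mxE; under eq_bigr do rewrite mxE.
  have [ip|ip] := ltnP i p.
    rewrite (bigD1 (Ordinal ip))//= eqxx big1 ?addr0 => [|j ji]; last first.
      by rewrite (_ : (i == j :> nat) = false) ?mul0r//; apply/negbTE; rewrite eq_sym.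
    rewrite (bigD1 (Ordinal ip))//= eqxx big1 ?addr0 => [|j ji]; last first.
      by rewrite (_ : (i == j :> nat) = false)//; apply/negbTE; rewrite eq_sym.
    by rewrite exprMn.
  rewrite !big1 ?expr0n// => j _; rewrite (_ : (i == j :> nat) = false) ?mul0r//;
    by apply/eqP => ij; have := ltn_ord j; rewrite -ij ltnNge ip.
under eq_bigr do rewrite E.
rewrite exchange_big /=; apply: eq_bigr => j _.
case: ltnP => [jm|jm].
  rewrite (bigD1 (Ordinal jm))//= eqxx big1 ?addr0// => i ij.
  by rewrite (_ : (i == j :> nat) = false)//; apply/negbTE.
rewrite big1// => i _; rewrite (_ : (i == j :> nat) = false)//.
by apply/eqP => ij; have := ltn_ord i; rewrite ij ltnNge jm.
Qed.

Lemma sqnorm_orthogonal_mul m p (U : 'M[R]_m) (B : 'M[R]_(m, p)) :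
  U^T *m U = 1%:M -> sqnorm (U *m B) = sqnorm B.
Proof. by move=> UU; rewrite /sqnorm mxdot_mull mulmxA UU mul1mx. Qed.

(** The first r + 1 right singular vectors span more dimensions than the rank of X, so X kills some
    nonzero V z in their span. There M - X acts as M, which stretches the vector by at least s_r. *)
Lemma singular_value_le m p (M X : 'M[R]_(m, p)) U s V r K :
  is_svd M U s V -> (\rank X <= r)%N -> 0 <= K -> opnorm_le (M - X) K ->
  (r < m)%N -> (r < p)%N -> s r <= K.
Proof.
move=> [UU VV s0 smono ME] Xr K0 MX rm rp.
pose Sel : 'M[R]_(r.+1, p) := \matrix_(i, j) (i == j :> nat)%:R.
(* [y] is a linear dependence between the first r + 1 columns of X V, which lie in a space of
   dimension at most r. *)
have [y y0 yQ] : exists2 y : 'rV[R]_(r.+1), y != 0 & y *m (Sel *m (X *m V)^T) = 0.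
  have : ~~ row_free (Sel *m (X *m V)^T).
    rewrite /row_free neq_ltn; apply/orP; left; rewrite ltnS.
    apply: leq_trans (mxrankM_maxr _ _) _; rewrite mxrank_tr.
    exact: leq_trans (mxrankM_maxl _ _) Xr.
  by rewrite -kermx_eq0 => /rowV0Pn[y /sub_kermxP yK y0]; exists y.
pose z := (y *m Sel)^T.
have zE (j : 'I_p) (jr : (j < r.+1)%N) : z j 0 = y 0 (Ordinal jr).
  rewrite mxE mxE (bigD1 (Ordinal jr))//= mxE eqxx mulr1 big1 ?addr0// => i ij.
  by rewrite mxE (_ : (i == j :> nat) = false) ?mulr0//; apply/negbTE.
have z_out (j : 'I_p) : (r < j)%N -> z j 0 = 0.
  move=> rj; rewrite mxE mxE big1// => i _.
  rewrite mxE (_ : (i == j :> nat) = false) ?mulr0//.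
  by apply/eqP => ij; have := ltn_ord i; rewrite ij ltnS leqNgt rj.
have z0 : 0 < sqnorm z.
  rewrite lt_def sqnorm_ge0 andbT; apply: contra y0 => /eqP/sqnorm_eq0 z0.
  apply/eqP/rowP => i; rewrite mxE.
  have ip : (i < p)%N by apply: leq_trans (ltn_ord i) rp.
  have := zE (Ordinal ip) (ltn_ord i); rewrite z0 mxE => ->.
  by congr (y _ _); apply: val_inj.
have XVz : X *m (V *m z) = 0.
  by rewrite mulmxA -[LHS]trmxK trmx_mul trmxK -mulmxA yQ trmx0.
have := MX (V *m z); rewrite mulmxBl XVz subr0.
rewrite -(@ler_pXn2r _ 2)// ?nnegrE ?mulr_ge0 ?fnorm_ge0//.
rewrite exprMn !fnorm_sqr sqnorm_orthogonal_mul// ME -/(sdiag m p s).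
rewrite -!mulmxA (mulmxA V^T) VV mul1mx sqnorm_orthogonal_mul// sqnorm_sdiag_mul => le.
have : s r ^+ 2 * sqnorm z <= K ^+ 2 * sqnorm z.
  apply: le_trans le; rewrite sqnorm_col mulr_sumr; apply: ler_sum => j _.
  have [jr|rj] := leqP j r.
    rewrite (leq_ltn_trans jr rm) ler_wpM2r ?sqr_ge0//.
    by rewrite lerXn2r ?nnegrE// smono.
  by rewrite z_out// expr0n /= !mulr0; case: ifP.
rewrite ler_pM2r// ler_pXn2r// nnegrE//.
Qed.

(** Subtracting the projection replaces the first r singular values of M by 0; the remaining ones
    are at most s_r, which [singular_value_le] bounds. *)
Lemma singular_projection m p r (M X : 'M[R]_(m, p)) (U : 'M[R]_(m, r)) K :
  first_left_singular_vectors M U -> (\rank X <= r)%N -> 0 <= K ->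
  opnorm_le (M - X) K ->
  [/\ U^T *m U = 1%:M & opnorm_le (M - U *m U^T *m M) K].
Proof.
move=> [le_rm [U' [s [V [svd UE]]]]] Xr K0 MX.
have [UU VV s0 smono ME] := svd.
pose Sel : 'M[R]_(m, r) := \matrix_(i, j) (i == widen_ord le_rm j)%:R.
have USel : U = U' *m Sel.
  apply/matrixP => a j; rewrite UE !mxE (bigD1 (widen_ord le_rm j))//= mxE eqxx mulr1.
  by rewrite big1 ?addr0// => i /negbTE ij; rewrite mxE ij mulr0.
have SS : Sel^T *m Sel = 1%:M.
  apply/matrixP => i j; rewrite !mxE (bigD1 (widen_ord le_rm j))//= !mxE eqxx mulr1.
  rewrite big1 ?addr0 => [|k /negbTE kj]; last by rewrite !mxE kj mulr0.
  by rewrite eq_sym -val_eqE.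
have U1 : U^T *m U = 1%:M by rewrite USel trmx_mul mulmxA -(mulmxA Sel^T) UU mulmx1.
have J i k : (Sel *m Sel^T) i k = ((i == k) && (i < r)%N)%:R.
  rewrite mxE; have [ir|ir] := ltnP i r.
    rewrite (bigD1 (Ordinal ir))//= !mxE.
    have -> : widen_ord le_rm (Ordinal ir) = i by exact: val_inj.
    rewrite eqxx mul1r big1 ?addr0 ?andbT 1?eq_sym// => l il.
    rewrite !mxE (_ : (i == _) = false) ?mul0r//; apply/negbTE.
    by apply: contra il => /eqP e; apply/eqP/val_inj; rewrite /= e.
  rewrite andbF big1// => l _; rewrite !mxE (_ : (i == _) = false) ?mul0r//.
  by apply/eqP => il; have := ltn_ord l; rewrite ltnNge (_ : l = i :> nat) ?ir// il.
split => // u; pose s' i : R := if (i < r)%N then 0 else s i.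
have U'U' : U' *m U'^T = 1%:M by exact: mulmx1C.
have E : M - U *m U^T *m M = U' *m sdiag m p s' *m V^T.
  have -> : sdiag m p s' = sdiag m p s - Sel *m Sel^T *m sdiag m p s.
    apply/matrixP => i j; rewrite !mxE (bigD1 i)//= J eqxx big1 ?addr0 => [|k ki].
      by rewrite /s' mxE; case: (i < r)%N; rewrite /= ?mul1r ?mul0r ?subrr ?subr0 ?mul0rn.
    by rewrite J eq_sym (negbTE ki) mul0r.
  rewrite mulmxBr mulmxBl -ME; congr (_ - _).
  by rewrite ME USel trmx_mul !mulmxA -(mulmxA _ U'^T U') UU mulmx1.
rewrite E -!mulmxA -(@ler_pXn2r _ 2)// ?nnegrE ?mulr_ge0 ?fnorm_ge0//.
rewrite exprMn !fnorm_sqr sqnorm_orthogonal_mul// sqnorm_sdiag_mul.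
have -> : sqnorm u = sqnorm (V^T *m u).
  by rewrite sqnorm_orthogonal_mul// trmxK; exact: mulmx1C.
rewrite (sqnorm_col (V^T *m u)) mulr_sumr; apply: ler_sum => j _.
case: ifP => [jm|_]; last by rewrite mulr_ge0// sqr_ge0.
rewrite ler_wpM2r ?sqr_ge0// /s'; case: ltnP => [_|rj]; first by rewrite expr0n sqr_ge0.
rewrite lerXn2r ?nnegrE// (le_trans (smono _ _ rj))//.
by apply: singular_value_le svd Xr K0 MX _ _; exact: leq_ltn_trans rj _.
Qed.

End operator_norm.

(** * Hadamard products with low-rank matrices *)

Section hadamard_low_rank.
Context {R : realType}.

(** The Schur multiplier bound. Entry i of the result is the inner product of row i of W with row i
    of A H, where H is V with its row j scaled by u_j; moreover |H|_F^2 <= b |u|^2. *)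
Lemma hadamard_factor_le m p l (A T : 'M[R]_(m, p)) (W : 'M[R]_(m, l)) (V : 'M[R]_(p, l))
    (a b K : R) : 0 <= a -> 0 <= b -> 0 <= K -> opnorm_le A K ->
  T = W *m V^T ->
  (forall i, sqnorm (row i W) <= a) -> (forall j, sqnorm (row j V) <= b) ->
  opnorm_le (\matrix_(i, j) (A i j * T i j)) (Num.sqrt (a * b) * K).
Proof.
move=> a0 b0 K0 AK TE Wa Vb u.
pose H : 'M[R]_(p, l) := \matrix_(j, k) (u j 0 * V j k).
rewrite -(@ler_pXn2r _ 2)// ?nnegrE ?mulr_ge0 ?fnorm_ge0 ?sqrtr_ge0//.
rewrite !exprMn !fnorm_sqr sqr_sqrtr ?mulr_ge0//.
have rowE i : ((\matrix_(i, j) (A i j * T i j)) *m u) i 0 = mxdot (row i W) (row i (A *m H)).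
  rewrite mxdotE big_ord1 mxE.
  transitivity (\sum_j \sum_k A i j * (W i k * V j k) * u j 0).
    apply: eq_bigr => j _; rewrite mxE TE mxE mulr_sumr mulr_suml.
    by apply: eq_bigr => k _; rewrite mxE.
  rewrite exchange_big; apply: eq_bigr => k _; rewrite !mxE mulr_sumr.
  by apply: eq_bigr => j _; rewrite !mxE; ring.
apply: (@le_trans _ _ (a * sqnorm (A *m H))).
  rewrite sqnorm_col (sqnorm_rows (A *m H)) mulr_sumr; apply: ler_sum => i _.
  rewrite rowE (le_trans (mxdot_CauchySchwarz _ _))// ler_wpM2r// sqnorm_ge0//.
rewrite -[leRHS]mulrA -[leRHS]mulrA; apply: (ler_wpM2l a0).
have AH : sqnorm (A *m H) <= K ^+ 2 * sqnorm H.
  by rewrite -!fnorm_sqr -exprMn lerXn2r ?nnegrE ?mulr_ge0 ?fnorm_ge0// fnorm_mulmx_le.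
apply: le_trans AH _; rewrite [leRHS]mulrCA; apply: ler_wpM2l; first exact: sqr_ge0.
rewrite sqnorm_rows sqnorm_col mulr_sumr; apply: ler_sum => j _.
have -> : row j H = u j 0 *: row j V by apply/rowP => k; rewrite !mxE.
by rewrite sqnormZ mulrC ler_wpM2r ?sqr_ge0.
Qed.

(** The two Schur complements of one block matrix yield the same determinant. *)
Lemma det_add_rank1 q (w : 'cV[R]_q) (v : 'rV[R]_q) :
  \det (1%:M + w *m v) = 1 + (v *m w) 0 0.
Proof.
have e1 : \det (block_mx 1%:M (- w) v 1%:M) = \det (1%:M + v *m w).
  have -> : block_mx 1%:M (- w) v 1%:M =
      block_mx 1%:M 0 v 1%:M *m block_mx 1%:M (- w) 0 (1%:M + v *m w).
    rewrite mulmx_block !(mul1mx, mul0mx, mulmx1, mulmx0, addr0, add0r) mulmxN.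
    by rewrite addrCA addNr addr0.
  by rewrite det_mulmx det_lblock det_ublock !det1 !mul1r.
have e2 : \det (block_mx 1%:M (- w) v 1%:M) = \det (1%:M + w *m v).
  have -> : block_mx 1%:M (- w) v 1%:M =
      block_mx (1%:M + w *m v) (- w) 0 1%:M *m block_mx 1%:M 0 v 1%:M.
    rewrite mulmx_block !(mul1mx, mul0mx, mulmx1, mulmx0, addr0, add0r) mulNmx.
    by rewrite addrK.
  by rewrite det_mulmx det_lblock det_ublock !det1 !mulr1.
by rewrite -e2 e1 det_mx11 !mxE.
Qed.

(** A crude count of the Leibniz terms, enough to make the supremum over designs finite. *)
Lemma norm_det_le q (M : 'M[R]_q) (B : R) : 0 <= B ->
  (forall i j, `|M i j| <= B) -> `|\det M| <= #|{perm 'I_q}|%:R * B ^+ q.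
Proof.
move=> B0 MB; apply: le_trans (ler_norm_sum _ _ _) _.
rewrite -sum1_card natr_sum mulr_suml; apply: ler_sum => s _.
rewrite mul1r normrM normrX normrN1 expr1n mul1r normr_prod.
apply: (@le_trans _ _ (\prod_(i < q) B)); last by rewrite prodr_const card_ord.
by apply: ler_prod => i _; rewrite normr_ge0 MB.
Qed.

Lemma Bernoulli_le q (t : R) : 0 <= t <= 1 -> 1 - q%:R * t <= (1 - t) ^+ q.
Proof.
move=> /andP[t0 t1]; elim: q => [|q IH]; first by rewrite mul0r subr0 expr0.
rewrite exprS -natr1.
have : (1 - t) * (1 - q%:R * t) <= (1 - t) * (1 - t) ^+ q.
  by rewrite ler_wpM2l// subr_ge0.
have : 0 <= q%:R * (t * t) by rewrite mulr_ge0// mulr_ge0.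
by nra.
Qed.

(** * Nearly D-optimal designs *)

Section design.
Context (m q : nat) (C : 'M[R]_(m, q)).
Hypothesis C_full : row_free C^T.
Hypothesis m_gt0 : (0 < m)%N.

Let simplex (w : 'I_m -> R) := (forall i, 0 <= w i) /\ \sum_i w i = 1.

(** The information matrix of optimal design theory: the second moment matrix of the rows of [C]
    under the weights w. *)
Definition information (w : 'I_m -> R) : 'M[R]_q :=
  \sum_i w i *: ((row i C)^T *m row i C).

Lemma informationE w a b : information w a b = \sum_i w i * (C i a * C i b).
Proof.
rewrite /information summxE; apply: eq_bigr => i _.
by rewrite !mxE big_ord1 !mxE.
Qed.

Let design_values : set R := [set `|\det (information w)| | w in [set w | simplex w]].

Let design_has_sup : has_sup design_values.
Proof.
split.
  exists `|\det (information (fun=> m%:R^-1))|; exists (fun=> m%:R^-1) => //=.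
  split; first by move=> i; rewrite invr_ge0.
  by rewrite sumr_const card_ord -[_ *+ m]mulr_natr mulVf// pnatr_eq0 -lt0n.
exists (#|{perm 'I_q}|%:R * sqnorm C ^+ q) => _ [w /= [w0 w1] <-].
apply: norm_det_le => [|a b]; first exact: sqnorm_ge0.
rewrite informationE -[leRHS]mul1r -w1 mulr_suml (le_trans (ler_norm_sum _ _ _))//.
apply: ler_sum => i _; rewrite normrM ger0_norm// ler_wpM2l//.
have CC c : C i c ^+ 2 <= sqnorm C.
  rewrite sqnormE (bigD1 i)//= (bigD1 c)//= -addrA lerDl addr_ge0//.
    by rewrite sumr_ge0// => k _; exact: sqr_ge0.
  by rewrite sumr_ge0// => k _; rewrite sumr_ge0// => l _; exact: sqr_ge0.
have := CC a; have := CC b; have := sqr_ge0 (C i a - C i b).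
have := sqr_ge0 (C i a + C i b).
by rewrite ler_norml; move=> h1 h2 h3 h4; apply/andP; split; nra.
Qed.

(** Uniform weights give a multiple of C^T C, which is invertible because C has full column rank. *)
Let design_sup_gt0 : 0 < sup design_values.
Proof.
apply: (@lt_le_trans _ _ `|\det (information (fun=> m%:R^-1))|); last first.
  apply: (ub_le_sup (proj2 design_has_sup)); exists (fun=> m%:R^-1) => //=.
  split; first by move=> i; rewrite invr_ge0.
  by rewrite sumr_const card_ord -[_ *+ m]mulr_natr mulVf// pnatr_eq0 -lt0n.
rewrite normr_gt0.
have -> : information (fun=> m%:R^-1) = m%:R^-1 *: (C^T *m C^T^T).
  apply/matrixP => a b; rewrite informationE !mxE mulr_sumr.
  by apply: eq_bigr => i _; rewrite !mxE.
rewrite detZ mulf_neq0 ?expf_neq0 ?invr_eq0 ?pnatr_eq0 -?lt0n//.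
by have := row_free_mulmx_tr C_full; rewrite unitmxE unitfE.
Qed.

(* If the leverage of row i exceeded q + e, moving mass t to it would multiply
   the determinant by (1 - t)^q (1 + t (q + e) / (1 - t)) > 1 + t e / 2. *)
Lemma near_optimal_design (e : R) : 0 < e -> exists w : 'I_m -> R,
  [/\ forall i, 0 <= w i, \sum_i w i = 1, information w \in unitmx &
      forall i, (row i C *m invmx (information w) *m (row i C)^T) 0 0 <= q%:R + e].
Proof.
move=> e0; set s := sup design_values.
pose k : R := q%:R + e + 1.
have q0 : 0 <= q%:R :> R by [].
have k1 : 1 <= k by rewrite /k; lra.
have k0 : 0 < k ^+ 2 by rewrite exprn_gt0//; lra.
(* Since q (q + e) <= k^2, this t keeps the second-order loss t^2 q (q + e) below t e / 2; it also
   ensures t < 1 and q t < 1. *)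
pose t : R := e / (2 * k ^+ 2).
have t0 : 0 < t by rewrite divr_gt0// mulr_gt0.
have tk : t * k ^+ 2 = e / 2 by rewrite /t; field; rewrite gt_eqF//; lra.
have t1 : t < 1 by rewrite -(ltr_pM2r k0) tk mul1r /k; nra.
have qt1 : q%:R * t < 1.
  by rewrite -(ltr_pM2r k0) -mulrA tk mul1r /k; nra.
have g0 : 1 < 1 + t * e / 2 by rewrite ltrDl divr_gt0// mulr_gt0.
have [|_ [w [w0 w1] <-] sx] := @sup_adherent _ design_values (s - s / (1 + t * e / 2)) _ design_has_sup.
  by rewrite subr_gt0 ltr_pdivrMr ?(lt_trans ltr01)// ltr_pMr.
rewrite -/s opprB addrCA subrr addr0 in sx.
have d0 : 0 < `|\det (information w)|.
  by apply: lt_trans sx; rewrite divr_gt0// (lt_trans ltr01).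
have uM : information w \in unitmx by rewrite unitmxE unitfE -normr_gt0.
exists w; split => // i; rewrite leNgt; apply/negP => big.
set M := information w in d0 uM sx big *.
set x := (_ *m _) 0 0 in big.
pose w' j := (1 - t) * w j + t * (j == i)%:R.
have ME : information w' = (1 - t) *: (M *m (1%:M +
    (t / (1 - t)) *: (invmx M *m (row i C)^T) *m row i C)).
  have t1' : 1 - t != 0 by rewrite gt_eqF// subr_gt0.
  rewrite mulmxDr mulmx1 -scalemxAl -scalemxAr !mulmxA mulmxV// mul1mx.
  rewrite scalerDr scalerA mulrCA mulfV// mulr1.
  rewrite /information /w'; under eq_bigr do rewrite scalerDl -(scalerA (1 - t)) -(scalerA t).
  rewrite big_split -scaler_sumr /=; congr (_ + _).
  rewrite (bigD1 i)//= eqxx scale1r big1 ?addr0// => j /negbTE ->.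
  by rewrite scale0r scaler0.
have : `|\det (information w')| <= s.
  apply: (ub_le_sup (proj2 design_has_sup)); exists w' => //=; split.
    by move=> j; rewrite addr_ge0// mulr_ge0// ?subr_ge0 ltW.
  rewrite big_split -!mulr_sumr /= w1 mulr1 (bigD1 i)//= eqxx big1 ?addr0 ?mulr1 ?subrK//.
  by move=> j /negbTE ->.
apply/negP; rewrite -ltNge ME detZ det_mulmx det_add_rank1.
rewrite -scalemxAr mxE mulmxA -/x.
have x0 : 0 < x by apply: lt_trans big; lra.
have tt : t <= t / (1 - t).
  rewrite ler_pdivlMr ?subr_gt0//.
  by have := sqr_ge0 t; rewrite expr2; nra.
have fx : 1 + t * x <= 1 + t / (1 - t) * x by rewrite lerD2l ler_wpM2r// ltW.
have f0 : 0 < 1 + t * x by rewrite addr_gt0// mulr_gt0.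
rewrite !normrM mulrCA.
have pt : 0 <= (1 - t) ^+ q by rewrite exprn_ge0// subr_ge0 ltW.
rewrite (ger0_norm pt) (ger0_norm (le_trans (ltW f0) fx)).
have B : 1 - q%:R * t <= (1 - t) ^+ q by apply: Bernoulli_le; rewrite !ltW.
(* (1 - q t)(1 + t (q + e)) = 1 + t e - t^2 q (q + e). *)
have key : 1 + t * e / 2 <= (1 - t) ^+ q * (1 + t / (1 - t) * x).
  apply: (@le_trans _ _ ((1 - q%:R * t) * (1 + t * x))); last first.
    by apply: ler_pM => //; [rewrite subr_ge0 ltW|exact: ltW].
  apply: (@le_trans _ _ ((1 - q%:R * t) * (1 + t * (q%:R + e)))); last first.
    by rewrite ler_wpM2l ?subr_ge0 ?ltW// ltrD2l ltr_pM2l.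
  have : t * (q%:R * (q%:R + e)) <= e / 2.
    rewrite -tk ler_pM2l// /k; nra.
  move=> h; have : t * (t * (q%:R * (q%:R + e))) <= t * (e / 2) by rewrite ler_pM2l.
  by nra.
have g1 : 0 < 1 + t * e / 2 by apply: lt_trans g0.
apply: (@lt_le_trans _ _ (`|\det M| * (1 + t * e / 2))).
  by rewrite -ltr_pdivrMr.
by rewrite ler_pM2l.
Qed.

End design.

(** Write T = C D with C of full column rank q, take a nearly optimal design w with information
    matrix M, and let N have the rows sqrt(w_i) C_i. Then T = (C M^(-1) N^T)(N D). Row i of the left
    factor has squared norm equal to the leverage of C_i, at most q + e, and column j of N D has
    squared norm sum_i w_i T_ij^2 <= tau^2. Letting e tend to 0 leaves sqrt(q) tau. *)
Lemma hadamard_opnorm_le m p (A T : 'M[R]_(m, p)) (tau K : R) :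
  0 <= tau -> 0 <= K -> opnorm_le A K -> (forall i j, `|T i j| <= tau) ->
  opnorm_le (\matrix_(i, j) (A i j * T i j)) (Num.sqrt (\rank T)%:R * tau * K).
Proof.
move=> tau0 K0 AK Ttau.
have [m0|m_gt0] := posnP m.
  move=> u; rewrite [X in X <= _](_ : _ = 0) ?mulr_ge0 ?sqrtr_ge0 ?fnorm_ge0//.
  rewrite /fnorm sqnormE big1 ?sqrtr0// => i.
  by have := ltn_ord i; rewrite {2}m0.
have [C [D [fC TE]]] : exists C : 'M[R]_(m, \rank T), exists D : 'M[R]_(\rank T, p),
    row_free C^T /\ T = C *m D.
  exists (col_base T), (row_base T); rewrite mulmx_base; split => //.
  by rewrite /row_free mxrank_tr; have := col_base_full T; rewrite /row_full => /eqP ->.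
move: (\rank T) C D fC TE => q C D fC TE u.
set x := fnorm _; set B := (tau * K * fnorm u) ^+ 2.
have B0 : 0 <= B by exact: sqr_ge0.
have near e : 0 < e -> x ^+ 2 <= (q%:R + e) * B.
  move=> e0; have [w [w0 w1 uM lev]] := near_optimal_design fC m_gt0 e0.
  set M := information C w in uM lev.
  pose N : 'M[R]_(m, q) := \matrix_(i, a) (Num.sqrt (w i) * C i a).
  have NN : N^T *m N = M.
    apply/matrixP => a b; rewrite informationE mxE; apply: eq_bigr => i _.
    by rewrite !mxE mulrACA -expr2 sqr_sqrtr.
  have qe0 : 0 <= q%:R + e by rewrite addr_ge0// ltW.
  have tM : (invmx M)^T = invmx M by rewrite trmx_inv -NN trmx_mul trmxK.
  have := @hadamard_factor_le _ _ _ A T (C *m invmx M *m N^T) (N *m D)^T (q%:R + e) (tau ^+ 2) K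
    qe0 (sqr_ge0 _) K0 AK.
  move=> /(_ _ _ _ u) H.
  have sa : Num.sqrt ((q%:R + e) * tau ^+ 2) ^+ 2 = (q%:R + e) * tau ^+ 2.
    by rewrite sqr_sqrtr// mulr_ge0// sqr_ge0.
  apply: (@le_trans _ _ ((Num.sqrt ((q%:R + e) * tau ^+ 2) * K * fnorm u) ^+ 2)); last first.
    by rewrite /B !exprMn sa le_eqVlt; apply/orP; left; apply/eqP; ring.
  rewrite lerXn2r ?nnegrE ?fnorm_ge0 ?mulr_ge0 ?sqrtr_ge0 ?fnorm_ge0//.
  apply: H => [|i|j].
  - by rewrite trmxK mulmxA -(mulmxA _ N^T N) NN mulmxKV.
  - rewrite row_mul -sqnorm_tr /sqnorm /mxdot trmxK trmx_mul trmxK.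
    rewrite mulmxA -(mulmxA _ N^T N) NN row_mul mulmxKV// trmx_mul tM mulmxA.
    by rewrite /mxtrace big_ord1.
  - rewrite -tr_col sqnorm_tr sqnorm_col -[leRHS]mul1r -w1 mulr_suml.
    apply: ler_sum => i _.
    have -> : col j (N *m D) i 0 = Num.sqrt (w i) * T i j.
      by rewrite TE !mxE mulr_sumr; apply: eq_bigr => a _; rewrite !mxE mulrA.
    rewrite exprMn sqr_sqrtr// ler_wpM2l// -real_normK ?num_real//.
    by rewrite lerXn2r ?nnegrE.
rewrite -(@ler_pXn2r _ 2)// ?nnegrE ?fnorm_ge0 ?mulr_ge0 ?sqrtr_ge0 ?fnorm_ge0//.
have sq : Num.sqrt q%:R ^+ 2 = q%:R :> R by rewrite sqr_sqrtr.
rewrite -(mulrA (Num.sqrt _)) -(mulrA (Num.sqrt _)) exprMn sq -/B.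
(* The design is taken with tolerance e / (B + 1), which also makes sense when B = 0. *)
apply/ler_addgt0Pr => e e0.
have B1 : 0 < B + 1 by rewrite ltr_wpDl.
apply: le_trans (near (e / (B + 1)) _) _; first by rewrite divr_gt0.
by rewrite mulrDl lerD2l mulrAC ler_pdivrMr// ler_pM2l// lerDl.
Qed.

End hadamard_low_rank.

(** * Tensors *)

Section projection_error.
Context {R : realType}.

Lemma sqnorm_projection m p r (U : 'M[R]_(m, r)) (B : 'M[R]_(m, p)) :
  U^T *m U = 1%:M ->
  sqnorm B = sqnorm (U *m U^T *m B) + sqnorm (B - U *m U^T *m B).
Proof.
move=> UU; set PB := U *m U^T *m B.
have PP : mxdot PB (B - PB) = 0.
  rewrite {1}/PB -mulmxA mxdot_mull mulmxBr /PB !mulmxA UU mul1mx subrr.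
  by rewrite /mxdot mulmx0 mxtrace0.
transitivity (sqnorm (PB + (B - PB))); first by rewrite addrCA subrr addr0.
by rewrite [LHS]sqnormD PP mulr0 addr0.
Qed.

Lemma fnorm_projection_le m p r (U : 'M[R]_(m, r)) (B : 'M[R]_(m, p)) :
  U^T *m U = 1%:M -> fnorm (U *m U^T *m B) <= fnorm B.
Proof.
by move=> /(sqnorm_projection B) E; rewrite ler_wsqrtr// E lerDl sqnorm_ge0.
Qed.

Lemma fnorm_coprojection_le m p r (U : 'M[R]_(m, r)) (B : 'M[R]_(m, p)) :
  U^T *m U = 1%:M -> fnorm (B - U *m U^T *m B) <= fnorm B.
Proof.
by move=> /(sqnorm_projection B) E; rewrite ler_wsqrtr// E lerDr sqnorm_ge0.
Qed.

(** X - P X inherits its rank from X, and P (M - X) from P even when M - X has large rank. Both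
    therefore pass from operator to Frobenius norm at the cost of sqrt(r). *)
Lemma low_rank_projection_error m p r (M X : 'M[R]_(m, p)) (U : 'M[R]_(m, r)) K :
  first_left_singular_vectors M U -> (\rank X <= r)%N -> 0 <= K ->
  opnorm_le (M - X) K ->
  [/\ U^T *m U = 1%:M,
      fnorm (X - U *m U^T *m X) <= 2 * (Num.sqrt r%:R * K) &
      fnorm (U *m U^T *m (M - X)) <= Num.sqrt r%:R * K].
Proof.
move=> HU Xr K0 MX; have [UU MPM] := singular_projection HU Xr K0 MX.
have rank_le q (k l : nat) (B : 'M[R]_(k, l)) : (\rank B <= q)%N ->
    Num.sqrt (\rank B)%:R <= Num.sqrt q%:R :> R.
  by move=> Bq; rewrite ler_wsqrtr// ler_nat.
split => //.
- have XB : opnorm_le (X - U *m U^T *m X) (2 * K).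
    (* With P = U U^T, X - P X = (M - P M) - (I - P)(M - X), and both terms have operator norm at
       most K. *)
    have -> : X - U *m U^T *m X = (M - U *m U^T *m M) +
        - ((M - X) - U *m U^T *m (M - X)).
      rewrite mulmxBr; move: (_ *m M) (_ *m X) => PM PX.
      by apply/matrixP => i j; rewrite !mxE; ring.
    rewrite mulr_natl mulr2n; apply: opnorm_leD => // u.
    rewrite mulNmx fnormN (mulmxBl (M - X)) -(mulmxA (U *m U^T)).
    exact: le_trans (fnorm_coprojection_le _ UU) (MX u).
  apply: le_trans (fnorm_le_rank _ XB) _; first by rewrite mulr_ge0.
  rewrite mulrCA; apply: ler_wpM2l => //; apply: ler_wpM2r => //; apply: rank_le.
  apply: leq_trans Xr; rewrite -{1}(mul1mx X) -mulmxBl.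
  exact: mxrankM_maxr.
- have EB : opnorm_le (U *m U^T *m (M - X)) K.
    move=> u; rewrite -(mulmxA (U *m U^T)).
    exact: le_trans (fnorm_projection_le _ UU) (MX u).
  apply: le_trans (fnorm_le_rank K0 EB) _; apply: ler_wpM2r => //; apply: rank_le.
  rewrite -mulmxA; apply: leq_trans (mxrankM_maxl _ _) _; exact: rank_leq_col.
Qed.

End projection_error.

(** * Unfoldings and successive mode products *)

Section tensor_norms.
Context {R : realType} {n : nat} {d : 'I_n -> nat}.
Implicit Types (X Y : tensor R d) (k : 'I_n).

Definition delete_idx k (i : midx d) : cidx d k :=
  [ffun j : {j | j != k} => i (val j)].

Lemma insert_delete k (i : midx d) : insert (i k) (delete_idx k i) = i.
Proof.
apply/ffunP => j; have [->|jk] := eqVneq j k; first by rewrite insert_in.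
have := insert_out (i k) (delete_idx k i) (exist _ j jk).
by rewrite /= => ->; rewrite ffunE.
Qed.

Lemma delete_insert k (s : 'I_(d k)) (c : cidx d k) : delete_idx k (insert s c) = c.
Proof. by apply/ffunP => j; rewrite ffunE insert_out. Qed.

Lemma big_insert (V : nmodType) k (F : midx d -> V) :
  \sum_i F i = \sum_s \sum_(c : cidx d k) F (insert s c).
Proof.
rewrite pair_big /=.
rewrite (reindex (fun p : 'I_(d k) * cidx d k => insert p.1 p.2))//=.
exists (fun i : midx d => (i k, delete_idx k i)) => [[s c] _|i _] /=.
  by rewrite insert_in delete_insert.
exact: insert_delete.
Qed.

Lemma big_enum_cidx (V : nmodType) k (F : cidx d k -> V) :
  \sum_c F c = \sum_(j < #|{: cidx d k}|) F (enum_val j).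
Proof. exact: (reindex _ (onW_bij _ (@enum_val_bij (cidx d k)))). Qed.

Lemma tnormF_unfold k X : tnormF X = fnorm (unfold k X).
Proof.
rewrite /tnormF /fnorm sqnormE (big_insert k); congr Num.sqrt; apply: eq_bigr => s _.
by rewrite big_enum_cidx; apply: eq_bigr => c _; rewrite mxE.
Qed.

(** The transpose appears because [mode_prod] sums over the row index of M. *)
Lemma unfold_mode_prod k X (M : 'M[R]_(d k)) :
  unfold k (mode_prod X M) = M^T *m unfold k X.
Proof.
apply/matrixP => s c; rewrite !mxE ffunE; apply: eq_bigr => s' _.
rewrite !mxE insert_in mulrC; congr (_ * X _); apply/ffunP => j; rewrite ffunE.
have [->|jk] := eqVneq j k; first by rewrite dfwithin insert_in.
rewrite dfwithout 1?eq_sym//.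
by rewrite (insert_out s (enum_val c) (exist _ j jk)) (insert_out s' (enum_val c) (exist _ j jk)).
Qed.

Lemma unfoldB k X Y : unfold k (X - Y) = unfold k X - unfold k Y.
Proof. by apply/matrixP => s c; rewrite !mxE !ffunE. Qed.

Lemma mode_prodB k X Y (M : 'M[R]_(d k)) :
  mode_prod (X - Y) M = mode_prod X M - mode_prod Y M.
Proof.
apply/ffunP => i; rewrite !ffunE -sumrB; apply: eq_bigr => s _.
by rewrite !ffunE mulrBl.
Qed.

Lemma tnormFD X Y : tnormF (X + Y) <= tnormF X + tnormF Y.
Proof.
have E (X' : tensor R d) : tnormF X' = fnorm (\col_(j < #|{: midx d}|) X' (enum_val j)).
  rewrite /fnorm sqnorm_col /tnormF; congr Num.sqrt.
  rewrite (reindex _ (onW_bij _ (@enum_val_bij (midx d)))) /=.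
  by apply: eq_bigr => j _; rewrite mxE.
rewrite !E [X in fnorm X <= _](_ : _ = (\col_j X (enum_val j)) + (\col_j Y (enum_val j))).
  exact: fnormD.
by apply/matrixP => j l; rewrite !mxE !ffunE.
Qed.

Lemma tnormFN X : tnormF (- X) = tnormF X.
Proof. by rewrite /tnormF; congr Num.sqrt; apply: eq_bigr => i _; rewrite !ffunE sqrrN. Qed.

Context (M : forall k, 'M[R]_(d k)).
Hypothesis M_contract : forall k X, tnormF (mode_prod X (M k)) <= tnormF X.

Let mode_fold (s : seq 'I_n) X : tensor R d :=
  foldl (fun X' k => mode_prod X' (M k)) X s.

Let mode_foldB s X Y : mode_fold s (X - Y) = mode_fold s X - mode_fold s Y.
Proof.
by rewrite /mode_fold; elim: s X Y => //= k s IH X Y; rewrite mode_prodB IH.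
Qed.

Let mode_fold_contract s X : tnormF (mode_fold s X) <= tnormF X.
Proof.
rewrite /mode_fold; elim: s X => //= k s IH X.
exact: le_trans (IH _) (M_contract _ _).
Qed.

Let mode_fold_error s X : tnormF (X - mode_fold s X) <=
  \sum_(k <- s) tnormF (X - mode_prod X (M k)).
Proof.
elim: s => [|k s IH].
  by rewrite big_nil /= subrr /tnormF big1 ?sqrtr0// => i _; rewrite ffunE expr0n.
rewrite big_cons [leRHS]addrC -[mode_fold _ _]/(mode_fold s (mode_prod X (M k))).
have -> : X - mode_fold s (mode_prod X (M k)) =
    (X - mode_fold s X) + mode_fold s (X - mode_prod X (M k)).
  by rewrite mode_foldB addrA subrK.
by apply: le_trans (tnormFD _ _) _; exact: lerD IH (mode_fold_contract _ _).
Qed.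

(** With Q the product over all modes, X - Q Y = (X - Q X) - Q (Y - X). The first term telescopes.
    In the second only the first projection is kept, since the others contract: one projection
    already makes the rank small, and its mode is left unspecified because its term will be absorbed
    in a sum over all modes. *)
Lemma mode_prods_error (n_gt0 : (0 < n)%N) X Y : exists k0 : 'I_n,
  tnormF (X - mode_prods Y M) <=
  \sum_(k < n) tnormF (X - mode_prod X (M k)) + tnormF (mode_prod (Y - X) (M k0)).
Proof.
have [k0 [s sE]] : exists k0, exists s, enum 'I_n = k0 :: s.
  case e : (enum 'I_n) => [|k0 s]; last by exists k0, s.
  by have := size_enum_ord n; rewrite e /=; lia.
exists k0.
have -> : X - mode_prods Y M = (X - mode_fold (enum 'I_n) X) -
    mode_fold (enum 'I_n) (Y - X).
  by rewrite mode_foldB opprB addrA subrK.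
apply: le_trans (tnormFD _ _) _; rewrite tnormFN; apply: lerD.
  by apply: le_trans (mode_fold_error _ _) _; rewrite big_enum.
by rewrite sE; exact: (mode_fold_contract s (mode_prod (Y - X) (M k0))).
Qed.

End tensor_norms.

Lemma big_sig_val (V : Type) (idx : V) (op : Monoid.com_law idx) (I : finType)
    (P : pred I) (F : I -> V) :
  \big[op/idx]_(i | P i) F i = \big[op/idx]_(x : {x | P x}) F (val x).
Proof.
rewrite (reindex_omap (val : {x | P x} -> I) insub); last first.
  by move=> i Pi; rewrite insubT.
by apply: eq_bigl => -[i Pi] /=; rewrite insubT ?Pi /= eqxx.
Qed.

(** * The weighted noise and its unfoldings *)

Section mode_noise.
Context {R : realType} {n : nat} {d : 'I_n -> nat}.

Lemma card_cidx k : #|{: cidx d k}| = (\prod_(j < n | j != k) d j)%N.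
Proof.
rewrite card_dep_ffun foldrE big_map big_enum /=.
under eq_bigr do rewrite card_ord.
by rewrite (big_sig_val _ (fun j => j != k)).
Qed.

Context (Omega : {set midx d}) (W : tensor R d).
Hypothesis W_gt0 : forall i, 0 < W i.

(** The factor put on each noise entry by W^(-1/2) and the mask; its square is the summand in
    [mu]. *)
Definition noise_coef (i : midx d) : R := (i \in Omega)%:R * W i `^ (- 2^-1).

Lemma noise_coef_sqr i : noise_coef i ^+ 2 = (i \in Omega)%:R / W i.
Proof.
rewrite exprMn powRN powR12_sqrt ?ltW// exprVn sqr_sqrtr ?ltW//.
by case: (i \in Omega); rewrite ?expr1n ?expr0n.
Qed.

Lemma row_noise_le k (s : 'I_(d k)) :
  \sum_(i : midx d | i k == s) noise_coef i ^+ 2 <= mu W Omega k ^+ 2.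
Proof.
have -> : \sum_(i : midx d | i k == s) noise_coef i ^+ 2 =
    \sum_(c : cidx d k) (insert s c \in Omega)%:R / W (insert s c).
  rewrite big_mkcond (big_insert k) (bigD1 s)//= [X in _ + X]big1 ?addr0.
    by apply: eq_bigr => c _; rewrite insert_in eqxx noise_coef_sqr.
  by move=> s' ss'; apply: big1 => c _; rewrite insert_in (negbTE ss').
rewrite /mu sqr_sqrtr; last by rewrite le_max bigmax_ge_id.
rewrite le_max; apply/orP; left.
exact: (le_bigmax _ (fun s => \sum_(c : cidx d k) (insert s c \in Omega)%:R / W (insert s c))).
Qed.

Lemma col_noise_le k (c : 'I_#|{: cidx d k}|) :
  \sum_(i : midx d | enum_rank (delete_idx k i) == c) noise_coef i ^+ 2 <= mu W Omega k ^+ 2.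
Proof.
have -> : \sum_(i : midx d | enum_rank (delete_idx k i) == c) noise_coef i ^+ 2 =
    \sum_(s < d k) (insert s (enum_val c) \in Omega)%:R / W (insert s (enum_val c)).
  rewrite big_mkcond (big_insert k); apply: eq_bigr => s _.
  rewrite (bigD1 (enum_val c))//= delete_insert enum_valK eqxx noise_coef_sqr.
  rewrite big1 ?addr0// => c' cc'; rewrite delete_insert.
  case: eqP => // e; move: cc'; rewrite -e enum_rankK eqxx//.
rewrite /mu sqr_sqrtr; last by rewrite le_max bigmax_ge_id.
rewrite le_max; apply/orP; right.
exact: (le_bigmax _ (fun c : cidx d k => \sum_(s < d k) (insert s c \in Omega)%:R / W (insert s c))).
Qed.

Context {disp : measure_display} {S : measurableType disp} (P : probability S R).
Context (Z : midx d -> {RV P >-> R}) (sigma : R).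
Hypothesis sigma_gt0 : 0 < sigma.
Hypothesis Z_indep : mutually_independent Z.
Hypothesis Z_normal : forall i, normally_distributed 0 sigma (Z i).

Definition noise (x : S) : tensor R d := [ffun i => Z i x * noise_coef i].

Lemma unfold_noise k x : unfold k (noise x) =
  gmatrix Z (fun i : midx d => i k) (fun i => enum_rank (delete_idx k i)) noise_coef x.
Proof.
apply/matrixP => s c; rewrite mxE ffunE /gmatrix summxE.
rewrite (bigD1 (insert s (enum_val c)))//= big1 ?addr0 => [|i ic].
  by rewrite !mxE insert_in delete_insert enum_valK !eqxx mulr1.
rewrite !mxE; case: eqP => [si|_]; last by rewrite mulr0.
case: eqP => [cE|_]; last by rewrite mulr0.
by move: ic; rewrite si cE enum_rankK insert_delete eqxx.
Qed.

Lemma mode_noise_event k : (forall j, (0 < d j)%N) ->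
  exists E : set S, [/\ measurable E, ((1 - (dim_sum d k)%:R^-1)%:E <= P E)%E &
    forall x, E x -> opnorm_le (unfold k (noise x))
      (2 * Num.sqrt (ln (dim_sum d k)%:R) * mu W Omega k * sigma)].
Proof.
move=> d_gt0; have mu0 : 0 <= mu W Omega k by exact: sqrtr_ge0.
have c_gt0 : (0 < #|{: cidx d k}|)%N by rewrite card_cidx prodn_cond_gt0.
have L0 : 0 <= ln (dim_sum d k)%:R :> R.
  by rewrite ln_ge0// ler1n /dim_sum addn_gt0 d_gt0.
(* The tail bound asks for v > 0. If [mu] vanishes, so do all the coefficients and the noise
   itself. *)
have [muk|muk] := eqVneq (mu W Omega k) 0.
  exists setT; split => //.
    have /= -> := @probability_setT _ _ _ P.
    by rewrite lee_fin gerBl invr_ge0.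
  move=> x _ u.
  have coef0 i : noise_coef i = 0.
    have /= := row_noise_le (i k); rewrite muk expr0n /= => le0.
    have /psumr_eq0P : \sum_(j : midx d | j k == i k) noise_coef j ^+ 2 = 0.
      by apply/eqP; rewrite eq_le le0 sumr_ge0// => j _; exact: sqr_ge0.
    move=> /(_ (fun j _ => sqr_ge0 _) i (eqxx _))/eqP.
    by rewrite sqrf_eq0 => /eqP.
  have -> : unfold k (noise x) = 0.
    by apply/matrixP => s c; rewrite !mxE ffunE coef0 mulr0.
  by rewrite mul0mx /fnorm sqnorm0 sqrtr0 muk mulr0 !mul0r.
have v0 : 0 < mu W Omega k ^+ 2 by rewrite exprn_gt0// lt_def muk mu0.
have [E [mE PE HE]] := gaussian_matrix_tail sigma_gt0 Z_indep Z_normal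
  (@row_noise_le k) (@col_noise_le k) (d_gt0 k) c_gt0 v0.
exists E; rewrite /dim_sum -card_cidx; split => // x Ex u.
rewrite unfold_noise -(@ler_pXn2r _ 2)// ?nnegrE ?mulr_ge0 ?fnorm_ge0 ?sqrtr_ge0 ?(ltW sigma_gt0)//.
rewrite fnorm_sqr; apply: le_trans (HE x Ex u) _.
rewrite !exprMn fnorm_sqr [Num.sqrt (ln _) ^+ 2]sqr_sqrtr; last first.
  by move: L0; rewrite /dim_sum card_cidx.
by rewrite le_eqVlt; apply/orP; left; apply/eqP; ring.
Qed.

End mode_noise.

(** The union bound on complements. It suits the noise events of the different modes, which share
    the same [Z] and need not be independent. *)
Lemma intersection_event (R : realType) (disp : measure_display) (S : measurableType disp)
    (P : probability S R) (I : finType) (E : I -> set S) (p : I -> R) :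
  (forall i, measurable (E i)) -> (forall i, ((1 - p i)%:E <= P (E i))%E) ->
  exists F : set S, [/\ measurable F, forall i, F `<=` E i &
    ((1 - \sum_i p i)%:E <= P F)%E].
Proof.
move=> mE PE.
have [F [mF FE PF]] : exists F : set S, [/\ measurable F,
    forall i, i \in index_enum I -> F `<=` E i &
    ((1 - \sum_(i <- index_enum I) p i)%:E <= P F)%E].
  elim: (index_enum I) => [|i s [F [mF FE PF]]].
    exists setT; split => //; rewrite big_nil subr0.
    by have /= -> := @probability_setT _ _ _ P.
  exists (E i `&` F); split.
  - exact: measurableI.
  - by move=> j; rewrite inE => /predU1P[->|/FE js] x [Ex Fx] //; exact: js.
  - have mEF : measurable (E i `&` F) by exact: measurableI.
    have : (P (~` E i `|` ~` F) <= P (~` E i) + P (~` F))%E.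
      by apply: measureU2; exact: measurableC.
    rewrite -setCI !probability_setC//.
    have /fineK <- := fin_num_measure P _ mEF.
    have := PE i; have := PF.
    have /fineK <- := fin_num_measure P _ mF.
    have /fineK <- := fin_num_measure P _ (mE i).
    rewrite -!EFinB -EFinD !lee_fin big_cons; lra.
by exists F; split => // i; apply: FE; rewrite mem_index_enum.
Qed.

(** * Conclusion *)

(** The square root of an outer product splits into a function of the k-th index and one of the
    other indices, so the weighting is a product with diagonal matrices on both sides. Absolute
    values occur because positivity is known for the product of the vector entries, not for each of
    them. *)
Lemma rank_unfold_weighted (R : realType) (n : nat) (d : 'I_n -> nat)
    (w : forall k, 'cV[R]_(d k)) (W_gt0 : forall i, 0 < outer w i) (T : tensor R d) k :
  (\rank (unfold k (hadamard (tpow (outer w) 2^-1) T)) <= \rank (unfold k T))%N.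
Proof.
pose g (c : cidx d k) : R := \prod_(j : {j | j != k}) w (val j) (c j) 0.
pose a : 'rV[R]_(d k) := \row_s Num.sqrt `|w k s 0|.
pose b : 'rV[R]_(#|{: cidx d k}|) := \row_c Num.sqrt `|g (enum_val c)|.
have -> : unfold k (hadamard (tpow (outer w) 2^-1) T) =
    diag_mx a *m unfold k T *m diag_mx b.
  apply/matrixP => s c; rewrite mul_mx_diag mxE mxE mul_diag_mx !mxE !ffunE.
  rewrite powR12_sqrt; last by have := W_gt0 (insert s (enum_val c)); rewrite ffunE => /ltW.
  rewrite (bigD1 k)//= (big_sig_val _ (fun j => j != k)) insert_in.
  under eq_bigr do rewrite insert_out.
  rewrite -/(g _) mulrAC; congr (_ * _).
  have := W_gt0 (insert s (enum_val c)); rewrite ffunE (bigD1 k)//=.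
  rewrite (big_sig_val _ (fun j => j != k)) insert_in.
  under eq_bigr do rewrite insert_out.
  rewrite -/(g _) => /ltW /ger0_norm <-.
  by rewrite normrM sqrtrM.
exact: leq_trans (mxrankM_maxl _ _) (mxrankM_maxr _ _).
Qed.

Theorem theoremB1 (R : realType) (n : nat) (d : 'I_n -> nat)
    (n_gt0 : (0 < n)%N) (d_gt0 : forall k, (0 < d k)%N)
    (w : forall k, 'cV[R]_(d k)) (W_gt0 : forall i, 0 < outer w i)
    (Omega : {set midx d})
    (T : tensor R d) (r : 'I_n -> nat)
    (rankT : forall k, tucker_rank T k = r k)
    (sigma : R) (sigma_gt0 : 0 < sigma)
    (disp : measure_display) (S : measurableType disp) (P : probability S R)
    (Z : midx d -> {RV P >-> R})
    (Z_indep : mutually_independent Z)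
    (Z_normal : forall i, normally_distributed 0 sigma (Z i))
    (Uhat : S -> forall k, 'M[R]_(d k, r k)) :
  let W := outer w in
  let Y x := hadamard (tindic Omega) (T + random_tensor Z x) in
  let WY x := hadamard (tpow W (- 2^-1)) (Y x) in
  let That x := hadamard (tpow W (- 2^-1))
    (mode_prods (WY x) (fun k => Uhat x k *m (Uhat x k)^T)) in
  (forall x k, first_left_singular_vectors (unfold k (WY x)) (Uhat x k)) ->
  with_probability_at_least P
    (1 - \sum_(k < n) (dim_sum d k)%:R^-1)
    [set x | tnormF (hadamard (tpow W 2^-1) (T - That x))
      <= (\sum_(k < n)
            6 * Num.sqrt ((r k)%:R * ln (dim_sum d k)%:R) * mu W Omega k)
         * sigma
       + (\sum_(k < n)
            3 * (r k)%:R * spectral_norm (unfold k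
              (hadamard (tpow W (- 2^-1)) (tindic Omega) - tpow W 2^-1)))
         * tnorm_oo T].
Proof.
move=> W Y WY That HU.
have W0 i : 0 < W i by exact: W_gt0.
have /choice[E HE] := fun k => mode_noise_event Omega W0 sigma_gt0 Z_indep Z_normal k d_gt0.
have [F [mF FE PF]] := intersection_event (p := fun k => (dim_sum d k)%:R^-1)
  (fun k => let: And3 mE _ _ := HE k in mE) (fun k => let: And3 _ PE _ := HE k in PE).
(* [F] constrains the noise alone. On it the bound is deterministic, whichever singular vectors
   [Uhat] picks. *)
exists F; split => // x Fx /=.
pose X := hadamard (tpow W 2^-1) T.
pose A := hadamard (tpow W (- 2^-1)) (tindic Omega) - tpow W 2^-1.
pose M k := Uhat x k *m (Uhat x k)^T.
have tau0 : 0 <= tnorm_oo T by exact: bigmax_ge_id.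
pose Ks k := 2 * Num.sqrt (ln (dim_sum d k)%:R) * mu W Omega k * sigma +
  Num.sqrt (r k)%:R * tnorm_oo T * spectral_norm (unfold k A).
have L0 k : 0 <= ln (dim_sum d k)%:R :> R.
  by rewrite ln_ge0// ler1n /dim_sum addn_gt0 d_gt0.
have spec0 k : 0 <= spectral_norm (unfold k A) by have [] := opnorm_le_spectral (unfold k A).
have Ks0 k : 0 <= Ks k.
  by rewrite addr_ge0 ?mulr_ge0 ?sqrtr_ge0// ltW.
have rankX k : (\rank (unfold k X) <= r k)%N.
  by rewrite -rankT; exact: rank_unfold_weighted.
have errE k : opnorm_le (unfold k (WY x) - unfold k X) (Ks k).
  (* In W^(-1/2) 1_Omega (T + Z) - W^(1/2) T, the Z part is the noise and the T part is the Hadamard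
     product of [A] and T. *)
  have -> : unfold k (WY x) - unfold k X = unfold k (noise Omega W Z x) +
      \matrix_(i, j) (unfold k A i j * unfold k T i j).
    apply/matrixP => i j; rewrite !mxE !ffunE /noise_coef /W !ffunE.
    by ring.
  apply: opnorm_leD.
    by have [_ _ HEk] := HE k; apply: HEk; exact: FE.
  rewrite -rankT; apply: hadamard_opnorm_le => //.
    by have [] := opnorm_le_spectral (unfold k A).
  by move=> i j; rewrite mxE; exact: (le_bigmax _ (fun i => `|T i|)).
have proj k := low_rank_projection_error (HU x k) (rankX k) (Ks0 k) (errE k).
have tM k : (M k)^T = M k by rewrite /M trmx_mul trmxK.
have M_contract k (X' : tensor R d) : tnormF (mode_prod X' (M k)) <= tnormF X'.
  rewrite !(tnormF_unfold k) unfold_mode_prod tM.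
  by have [UU _ _] := proj k; exact: fnorm_projection_le.
have -> : hadamard (tpow W 2^-1) (T - That x) = X - mode_prods (WY x) M.
  apply/ffunP => i; have := W_gt0 i; rewrite !ffunE => Wi; rewrite mulrBr; congr (_ - _).
  by rewrite powRN mulrA mulfV ?mul1r// gt_eqF// powR_gt0.
have [k0 err] := mode_prods_error M_contract n_gt0 X (WY x).
apply: le_trans err _.
(* The 3 is 2 per mode for X, plus the single term of mode [k0], which is at most the sum over all
   modes. *)
apply: (@le_trans _ _ (\sum_(k < n) 3 * (Num.sqrt (r k)%:R * Ks k))).
  apply: (@le_trans _ _ (\sum_(k < n) 2 * (Num.sqrt (r k)%:R * Ks k) +
      Num.sqrt (r k0)%:R * Ks k0)).
    apply: lerD.
      apply: ler_sum => k _; rewrite (tnormF_unfold k) unfoldB unfold_mode_prod tM.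
      by have [] := proj k.
    rewrite (tnormF_unfold k0) unfold_mode_prod tM unfoldB.
    by have [] := proj k0.
  rewrite -!mulr_sumr.
  have : Num.sqrt (r k0)%:R * Ks k0 <= \sum_(k < n) Num.sqrt (r k)%:R * Ks k.
    rewrite (bigD1 k0)//= lerDl sumr_ge0// => k _.
    by rewrite mulr_ge0 ?sqrtr_ge0.
  by lra.
rewrite !mulr_suml -big_split /= ler_sum// => k _.
(* In the bias, sqrt(r_k) from the Frobenius norm meets sqrt(r_k) from the Hadamard bound and makes
   r_k; in the noise, 6 is 3 times the 2 of the tail bound. *)
have rr : Num.sqrt (r k)%:R * Num.sqrt (r k)%:R = (r k)%:R :> R.
  by rewrite -expr2 sqr_sqrtr.
rewrite /Ks sqrtrM// -[X in _ + 3 * X * _ * _]rr le_eqVlt; apply/orP; left; apply/eqP.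
by ring.
Qed.
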